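(* Let $\lambda\in\mathbb{C}$ with $|\lambda|=1$ and let $\varphi\in S(\mathbb{D})$. Suppose that the composition operator $C_\varphi$ is bounded on the little Bloch space $\mathcal{B}_0$. Then the operator $\lambda C_\varphi$ is not hypercyclic on $\mathcal{B}_0$.
   Context: $\mathbb{D}=\{z\in\mathbb{C}:|z|<1\}$, $H(\mathbb{D})$ is the space of holomorphic functions on $\mathbb{D}$, and $S(\mathbb{D})$ is the set of all holomorphic self-maps of $\mathbb{D}$. For $\varphi\in S(\mathbb{D})$, $C_\varphi f=f\circ\varphi$ for $f\in H(\mathbb{D})$. The Bloch space is $\mathcal{B}=\{f\in H(\mathbb{D}):\|f\|_{\mathcal{B}}=\sup_{z\in\mathbb{D}}(1-|z|^2)|f'(z)|<\infty\}$; the little Bloch space is $\mathcal{B}_0=\{f\in\mathcal{B}:\lim_{|z|\to1}(1-|z|^2)|f'(z)|=0\}$. Both carry the complete norm $\|f\|_{Bloch}=|f(0)|+\|f\|_{\mathcal{B}}$. ''$C_\varphi$ is bounded on $\mathcal{B}_0$'' means that $C_\varphi$ is a bounded linear operator from $\mathcal{B}_0$ to $\mathcal{B}_0$. A continuous linear operator $T$ on a separable infinite-dimensional Banach space $X$ is hypercyclic if there is $f\in X$ whose orbit $\{T^nf:n=0,1,2,\dots\}$ is dense in $X$. *)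

(* Defs.v *)
From Stdlib Require Import Reals Lra Psatz.
From Stdlib Require Import FunctionalExtensionality ProofIrrelevance.
From Stdlib Require Import PropExtensionality ClassicalEpsilon.
From Coquelicot Require Import Coquelicot.
Open Scope R_scope.

Definition in_disc (z : C) : Prop := Cmod z < 1.

(* Functions on the disc are represented by total functions [C -> C]; only
   their values on the (open) disc matter in the predicates below. *)

Definition holomorphic_on_disc (f : C -> C) : Prop :=
  forall z : C, in_disc z -> @ex_derive C_AbsRing C_NormedModule f z.

Definition holomorphic_self_map (phi : C -> C) : Prop :=
  holomorphic_on_disc phi /\ forall z : C, in_disc z -> in_disc (phi z).

Definition bloch_weight (f : C -> C) (z : C) : R :=
  (1 - Cmod z ^ 2) * Cmod (C_derive f z).

Definition bloch_seminorm (f : C -> C) : Rbar :=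
  Lub_Rbar (fun r : R => exists z : C, in_disc z /\ r = bloch_weight f z).

Definition bloch (f : C -> C) : Prop :=
  holomorphic_on_disc f /\ Rbar_lt (bloch_seminorm f) p_infty.

Definition little_bloch (f : C -> C) : Prop :=
  bloch f /\
  forall eps : R, 0 < eps ->
    exists r : R, r < 1 /\
      forall z : C, r < Cmod z < 1 -> bloch_weight f z < eps.

(* [real] is only meaningful when the seminorm is finite, i.e. on [bloch]. *)
Definition bloch_norm (f : C -> C) : R :=
  Cmod (f (RtoC 0)) + real (bloch_seminorm f).

(* An element of the little Bloch space is stored as its extension by zero,
   so that Leibniz equality is equality on the disc. *)
Record B0 : Type := mkB0 {
  B0_fun :> C -> C;
  B0_little_bloch : little_bloch B0_fun;
  B0_outside : forall z : C, ~ in_disc z -> B0_fun z = RtoC 0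
}.

Lemma B0_ext (f g : B0) : (forall z, in_disc z -> f z = g z) -> f = g.
Proof.
destruct f as [f Hf Of], g as [g Hg Og]; simpl; intros H.
assert (E : f = g).
{ apply functional_extensionality; intros z.
  destruct (Rlt_dec (Cmod z) 1) as [L|L]; [now apply H|].
  now rewrite Of, Og. }
subst g; f_equal; apply proof_irrelevance.
Qed.

Lemma is_derive_C_derive f z :
  holomorphic_on_disc f -> in_disc z ->
  @is_derive C_AbsRing C_NormedModule f z (C_derive f z).
Proof.
intros H Hz; apply C_derive_correct; [exact z | now apply H].
Qed.

Lemma weight_pos z : in_disc z -> 0 < 1 - Cmod z ^ 2.
Proof.
unfold in_disc; intros H; assert (P := Cmod_ge_0 z); nra.
Qed.

Lemma bloch_weight_ge0 f z : in_disc z -> 0 <= bloch_weight f z.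
Proof.
intros H; apply Rmult_le_pos; [now left; apply weight_pos | apply Cmod_ge_0].
Qed.

Lemma in_disc_0 : in_disc (RtoC 0).
Proof. unfold in_disc; rewrite Cmod_0; lra. Qed.

Lemma bloch_seminorm_ge0 f : Rbar_le 0 (bloch_seminorm f).
Proof.
unfold bloch_seminorm.
destruct (Lub_Rbar_correct
  (fun r : R => exists z : C, in_disc z /\ r = bloch_weight f z)) as [U _].
apply Rbar_le_trans with (bloch_weight f (RtoC 0)).
- apply bloch_weight_ge0, in_disc_0.
- apply U; exists (RtoC 0); split; [apply in_disc_0 | reflexivity].
Qed.

Lemma bloch_weight_le f z :
  bloch f -> in_disc z -> bloch_weight f z <= real (bloch_seminorm f).
Proof.
intros [_ F] Hz; assert (P := bloch_seminorm_ge0 f).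
unfold bloch_seminorm in *.
destruct (Lub_Rbar_correct
  (fun r : R => exists z : C, in_disc z /\ r = bloch_weight f z)) as [U _].
specialize (U (bloch_weight f z) (ex_intro _ z (conj Hz eq_refl))).
destruct (Lub_Rbar _); simpl in *; tauto.
Qed.

Lemma bloch_seminorm_le f (M : R) :
  (forall z, in_disc z -> bloch_weight f z <= M) ->
  Rbar_le (bloch_seminorm f) M.
Proof.
intros H; unfold bloch_seminorm.
destruct (Lub_Rbar_correct
  (fun r : R => exists z : C, in_disc z /\ r = bloch_weight f z)) as [_ L].
apply L; intros r [z [Hz ->]]; now apply H.
Qed.

Lemma real_bloch_seminorm_ge0 f : 0 <= real (bloch_seminorm f).
Proof.
assert (P := bloch_seminorm_ge0 f).
destruct (bloch_seminorm f); simpl in *; lra.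
Qed.

Lemma real_bloch_seminorm_le f (M : R) :
  (forall z, in_disc z -> bloch_weight f z <= M) ->
  real (bloch_seminorm f) <= M.
Proof.
intros H; assert (L := bloch_seminorm_le f M H).
assert (P := bloch_seminorm_ge0 f).
destruct (bloch_seminorm f); simpl in *; lra || tauto.
Qed.

Lemma bloch_intro f (M : R) :
  holomorphic_on_disc f ->
  (forall z, in_disc z -> bloch_weight f z <= M) -> bloch f.
Proof.
intros Hf H; split; [exact Hf|].
now apply Rbar_le_lt_trans with (Finite M); [apply bloch_seminorm_le|].
Qed.

Lemma bloch_norm_ge0 f : 0 <= bloch_norm f.
Proof.
apply Rplus_le_le_0_compat;
  [apply Cmod_ge_0 | apply real_bloch_seminorm_ge0].
Qed.

Lemma is_derive_plus_C f g z : holomorphic_on_disc f ->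
  holomorphic_on_disc g -> in_disc z ->
  @is_derive C_AbsRing C_NormedModule (fun w => Cplus (f w) (g w)) z
    (Cplus (C_derive f z) (C_derive g z)).
Proof.
intros Hf Hg Hz.
exact (@is_derive_plus C_AbsRing C_NormedModule f g z _ _
  (is_derive_C_derive f z Hf Hz) (is_derive_C_derive g z Hg Hz)).
Qed.

Lemma is_derive_scal_C (a : C) f z : holomorphic_on_disc f -> in_disc z ->
  @is_derive C_AbsRing C_NormedModule (fun w => Cmult a (f w)) z
    (Cmult a (C_derive f z)).
Proof.
intros Hf Hz.
eapply filterdiff_ext_lin.
- exact (@filterdiff_scal_r_fct C_AbsRing (AbsRing_NormedModule C_AbsRing)
    C_NormedModule _
    (filter_filter
      (ProperFilter := @locally_filter (AbsRing_UniformSpace C_AbsRing) z))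
    a f _ Cmult_comm (is_derive_C_derive f z Hf Hz)).
- intros y; change (Cmult a (Cmult y (C_derive f z))
    = Cmult y (Cmult a (C_derive f z))); ring.
Qed.

Lemma little_bloch_plus f g : little_bloch f -> little_bloch g ->
  little_bloch (fun z => Cplus (f z) (g z)) /\
  real (bloch_seminorm (fun z => Cplus (f z) (g z)))
    <= real (bloch_seminorm f) + real (bloch_seminorm g).
Proof.
intros [Bf Lf] [Bg Lg].
assert (W : forall z, in_disc z ->
  bloch_weight (fun z => Cplus (f z) (g z)) z
    <= bloch_weight f z + bloch_weight g z).
{ intros z Hz; unfold bloch_weight.
  rewrite (is_C_derive_unique (fun w => Cplus (f w) (g w)) z _
    (is_derive_plus_C f g z (proj1 Bf) (proj1 Bg) Hz)).
  rewrite <- Rmult_plus_distr_l; apply Rmult_le_compat_l;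
    [left; now apply weight_pos | apply Cmod_triangle]. }
assert (W' : forall z, in_disc z ->
  bloch_weight (fun z => Cplus (f z) (g z)) z
    <= real (bloch_seminorm f) + real (bloch_seminorm g)).
{ intros z Hz; apply Rle_trans with (1 := W z Hz).
  apply Rplus_le_compat; now apply bloch_weight_le. }
split; [split|].
- apply bloch_intro with (2 := W').
  intros z Hz; eexists; apply is_derive_plus_C; trivial; [apply Bf | apply Bg].
- intros eps He.
  destruct (Lf (eps / 2)) as [r [Hr Hf]]; [lra|].
  destruct (Lg (eps / 2)) as [s [Hs Hg]]; [lra|].
  exists (Rmax r s); split; [now apply Rmax_lub_lt|].
  intros z [Hz1 Hz2].
  assert (r <= Rmax r s /\ s <= Rmax r s) as [Mr Ms]
    by (split; [apply Rmax_l | apply Rmax_r]).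
  apply Rle_lt_trans with (1 := W z Hz2).
  specialize (Hf z (conj (Rle_lt_trans _ _ _ Mr Hz1) Hz2)).
  specialize (Hg z (conj (Rle_lt_trans _ _ _ Ms Hz1) Hz2)).
  lra.
- now apply real_bloch_seminorm_le.
Qed.

Lemma little_bloch_scal (a : C) f : little_bloch f ->
  little_bloch (fun z => Cmult a (f z)) /\
  real (bloch_seminorm (fun z => Cmult a (f z)))
    <= Cmod a * real (bloch_seminorm f).
Proof.
intros [Bf Lf].
assert (Pa := Cmod_ge_0 a).
assert (W : forall z, in_disc z ->
  bloch_weight (fun z => Cmult a (f z)) z = Cmod a * bloch_weight f z).
{ intros z Hz; unfold bloch_weight.
  rewrite (is_C_derive_unique (fun w => Cmult a (f w)) z _
    (is_derive_scal_C a f z (proj1 Bf) Hz)).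
  rewrite Cmod_mult; ring. }
assert (W' : forall z, in_disc z ->
  bloch_weight (fun z => Cmult a (f z)) z
    <= Cmod a * real (bloch_seminorm f)).
{ intros z Hz; rewrite (W z Hz).
  apply Rmult_le_compat_l; [exact Pa | now apply bloch_weight_le]. }
split; [split|].
- apply bloch_intro with (2 := W').
  intros z Hz; eexists; apply is_derive_scal_C; trivial; apply Bf.
- intros eps He.
  destruct (Lf (eps / (Cmod a + 1))) as [r [Hr Hf]].
  { apply Rdiv_lt_0_compat; lra. }
  exists r; split; [exact Hr|].
  intros z Hz; rewrite (W z (proj2 Hz)).
  specialize (Hf z Hz).
  assert (P := bloch_weight_ge0 f z (proj2 Hz)).
  apply Rle_lt_trans with ((Cmod a + 1) * bloch_weight f z); [nra|].
  replace eps with ((Cmod a + 1) * (eps / (Cmod a + 1))) by (field; lra).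
  apply Rmult_lt_compat_l; lra.
- now apply real_bloch_seminorm_le.
Qed.

Lemma little_bloch_zero : little_bloch (fun _ => RtoC 0).
Proof.
assert (W : forall z, bloch_weight (fun _ => RtoC 0) z = 0).
{ intros z; unfold bloch_weight.
  rewrite (is_C_derive_unique (fun _ => RtoC 0) z (RtoC 0)
    (@is_derive_const C_AbsRing C_NormedModule (RtoC 0) z)).
  rewrite Cmod_0; ring. }
split.
- apply bloch_intro with 0.
  + intros z _; eexists; apply is_derive_const.
  + intros z _; rewrite W; lra.
- intros eps He; exists 0; split; [lra|]; intros z _; now rewrite W.
Qed.

Lemma Re_le_Cmod (z : C) : Rabs (Re z) <= Cmod z.
Proof. eapply Rle_trans; [apply Rmax_l | apply Rmax_Cmod]. Qed.

Lemma mean_value_inequality f (z w : C) (M : R) :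
  (forall t : R, 0 <= t <= 1 ->
     @is_derive C_AbsRing C_NormedModule f
       (Cplus z (Cmult (RtoC t) (Cminus w z)))
       (C_derive f (Cplus z (Cmult (RtoC t) (Cminus w z)))) /\
     Cmod (C_derive f (Cplus z (Cmult (RtoC t) (Cminus w z)))) <= M) ->
  Cmod (Cminus (f w) (f z)) <= M * Cmod (Cminus w z).
Proof.
intros H.
set (d := Cminus w z) in *.
set (p := fun t : R => Cplus z (Cmult (RtoC t) d)).
set (c := Cconj (Cminus (f w) (f z))).
set (u := fun t : R => Re (Cmult c (f (p t)))).
set (du := fun t : R => Re (Cmult c (Cmult (C_derive f (p t)) d))).
assert (Pd := Cmod_ge_0 d); assert (Pc := Cmod_ge_0 c).
assert (D : forall t, 0 <= t <= 1 -> is_derive u t (du t)).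
{ intros t Ht.
  destruct (H t Ht) as [[_ Dw] _].
  split; [apply is_linear_scal_l|].
  intros x Hx.
  rewrite <- (is_filter_lim_locally_unique _ _ Hx); clear x Hx.
  intros eps.
  assert (K : 0 < Cmod c * Cmod d + 1) by nra.
  assert (He : 0 < eps / (Cmod c * Cmod d + 1)).
  { apply Rdiv_lt_0_compat; [apply cond_pos | exact K]. }
  specialize (Dw _ (fun P H => H) (mkposreal _ He)).
  destruct Dw as [r Hr].
  assert (Hr' : 0 < r / (Cmod d + 1)).
  { apply Rdiv_lt_0_compat; [apply cond_pos | lra]. }
  exists (mkposreal _ Hr'); intros s Hs.
  change (Rabs (s - t) < r / (Cmod d + 1)) in Hs.
  assert (Es : Cminus (p s) (p t) = Cmult (RtoC (s - t)) d)
    by (unfold p; rewrite RtoC_minus; ring).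
  specialize (Hr (p s)).
  change (Cmod (Cminus (p s) (p t)) < r ->
    Cmod (Cminus (Cminus (f (p s)) (f (p t)))
      (Cmult (Cminus (p s) (p t)) (C_derive f (p t))))
    <= eps / (Cmod c * Cmod d + 1) * Cmod (Cminus (p s) (p t))) in Hr.
  rewrite Es, Cmod_mult, Cmod_R in Hr.
  change (Rabs (u s - u t - (s - t) * du t) <= eps * Rabs (s - t)).
  assert (Ps := Rabs_pos (s - t)).
  replace (u s - u t - (s - t) * du t) with
    (Re (Cmult c (Cminus (Cminus (f (p s)) (f (p t)))
      (Cmult (Cmult (RtoC (s - t)) d) (C_derive f (p t))))))
    by (unfold u, du; simpl; ring).
  apply Rle_trans with (1 := Re_le_Cmod _); rewrite Cmod_mult.
  assert (L : Rabs (s - t) * Cmod d < r).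
  { apply Rle_lt_trans with (Rabs (s - t) * (Cmod d + 1)); [nra|].
    replace (pos r) with (r / (Cmod d + 1) * (Cmod d + 1)) by (field; lra).
    apply Rmult_lt_compat_r; lra. }
  specialize (Hr L).
  apply Rle_trans with
    (Cmod c * (eps / (Cmod c * Cmod d + 1) * (Rabs (s - t) * Cmod d))).
  { now apply Rmult_le_compat_l. }
  replace (eps * Rabs (s - t)) with
    (eps / (Cmod c * Cmod d + 1) * Rabs (s - t) * (Cmod c * Cmod d + 1))
    by (field; lra).
  assert (0 <= eps / (Cmod c * Cmod d + 1) * Rabs (s - t)) by nra.
  nra. }
destruct (MVT_gen u 0 1 du) as [t [Ht Et]].
- rewrite Rmin_left, Rmax_right by lra; intros x Hx; apply D; lra.
- rewrite Rmin_left, Rmax_right by lra; intros x Hx.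
  apply continuity_pt_filterlim.
  apply (@ex_derive_continuous R_AbsRing R_NormedModule u x).
  now exists (du x); apply D.
- rewrite Rmin_left, Rmax_right in Ht by lra.
  destruct (H t Ht) as [_ B].
  set (a := Cmod (Cminus (f w) (f z))).
  assert (Ea : Cmod c = a) by apply Cmod_conj.
  assert (E : u 1 - u 0 = a * a).
  { unfold u, p, a, d, c.
    replace (Cplus z (Cmult (RtoC 1) (Cminus w z))) with w by ring.
    replace (Cplus z (Cmult (RtoC 0) (Cminus w z))) with z by ring.
    generalize (f w) (f z); intros [x1 y1] [x2 y2].
    unfold Cmod; rewrite sqrt_sqrt by (apply Rplus_le_le_0_compat; apply pow2_ge_0).
    simpl; ring. }
  rewrite E in Et.
  assert (Le : a * a <= a * (M * Cmod d)).
  { rewrite Et; rewrite Rminus_0_r, Rmult_1_r.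
    apply Rle_trans with (1 := Rle_abs _).
    apply Rle_trans with (1 := Re_le_Cmod _).
    rewrite !Cmod_mult, Ea.
    apply Rmult_le_compat_l; [rewrite <- Ea; exact Pc|].
    now apply Rmult_le_compat_r. }
  assert (Pa : 0 <= a) by (rewrite <- Ea; exact Pc).
  assert (PM : 0 <= M) by (apply Rle_trans with (2 := B); apply Cmod_ge_0).
  destruct (Rle_lt_or_eq_dec _ _ Pa) as [Pa'|Za]; nra.
Qed.

Lemma segment_le (z w : C) (t r : R) : 0 <= t <= 1 ->
  Cmod z <= r -> Cmod w <= r ->
  Cmod (Cplus z (Cmult (RtoC t) (Cminus w z))) <= r.
Proof.
intros Ht Hz Hw.
replace (Cplus z (Cmult (RtoC t) (Cminus w z))) with
  (Cplus (Cmult (RtoC (1 - t)) z) (Cmult (RtoC t) w))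
  by (rewrite RtoC_minus; ring).
apply Rle_trans with (1 := Cmod_triangle _ _).
rewrite !Cmod_mult, !Cmod_R, !Rabs_pos_eq by lra.
nra.
Qed.

(* On the disc of radius [r < 1] the Bloch seminorm bounds the Lipschitz
   constant. *)
Lemma bloch_lipschitz f (z w : C) (r : R) : bloch f -> r < 1 ->
  Cmod z <= r -> Cmod w <= r ->
  Cmod (Cminus (f w) (f z))
    <= real (bloch_seminorm f) / (1 - r ^ 2) * Cmod (Cminus w z).
Proof.
intros Hf Hr Hz Hw.
assert (P0 := Cmod_ge_0 z).
apply mean_value_inequality; intros t Ht.
assert (Hp := segment_le z w t r Ht Hz Hw).
set (p := Cplus z (Cmult (RtoC t) (Cminus w z))) in *.
assert (Dp : in_disc p) by (unfold in_disc; lra).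
split; [apply is_derive_C_derive; trivial; apply Hf|].
assert (B := bloch_weight_le f p Hf Dp); unfold bloch_weight in B.
assert (P1 := Cmod_ge_0 p); assert (P2 := Cmod_ge_0 (C_derive f p)).
assert (0 < 1 - r ^ 2) by nra.
apply Rmult_le_reg_r with (1 - r ^ 2); [assumption|].
unfold Rdiv; rewrite Rmult_assoc, Rinv_l, Rmult_1_r by lra.
apply Rle_trans with (2 := B).
rewrite Rmult_comm; apply Rmult_le_compat_r; nra.
Qed.

Definition B0_zero : B0 :=
  mkB0 (fun _ => RtoC 0) little_bloch_zero (fun _ _ => eq_refl).

Definition B0_plus (f g : B0) : B0.
Proof.
refine (mkB0 (fun z => Cplus (f z) (g z)) _ _).
- apply little_bloch_plus; apply B0_little_bloch.
- abstract (intros z Hz; rewrite !B0_outside by exact Hz; ring).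
Defined.

Definition B0_scal (a : C) (f : B0) : B0.
Proof.
refine (mkB0 (fun z => Cmult a (f z)) _ _).
- apply little_bloch_scal, B0_little_bloch.
- abstract (intros z Hz; rewrite B0_outside by exact Hz; ring).
Defined.

Definition B0_opp (f : B0) : B0 := B0_scal (RtoC (-1)) f.

Definition B0_norm (f : B0) : R := bloch_norm f.

Lemma B0_norm_triangle f g : B0_norm (B0_plus f g) <= B0_norm f + B0_norm g.
Proof.
unfold B0_norm, bloch_norm; simpl.
assert (H := proj2 (little_bloch_plus f g (B0_little_bloch f)
  (B0_little_bloch g))).
assert (T := Cmod_triangle (f (RtoC 0)) (g (RtoC 0))).
lra.
Qed.

Lemma B0_norm_scal a f : B0_norm (B0_scal a f) <= Cmod a * B0_norm f.
Proof.
unfold B0_norm, bloch_norm; simpl.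
assert (H := proj2 (little_bloch_scal a f (B0_little_bloch f))).
rewrite Cmod_mult; lra.
Qed.

Lemma B0_value_le (f : B0) z : in_disc z ->
  Cmod (f z) <= B0_norm f * (1 + / (1 - Cmod z ^ 2)).
Proof.
intros Hz; unfold B0_norm, bloch_norm.
assert (W := weight_pos z Hz).
assert (L := bloch_lipschitz f (RtoC 0) z (Cmod z)
  (proj1 (B0_little_bloch f)) Hz).
rewrite Cmod_0 in L.
specialize (L (Cmod_ge_0 z) (Rle_refl _)).
replace (Cminus z (RtoC 0)) with z in L by ring.
assert (P := real_bloch_seminorm_ge0 f).
assert (P0 := Cmod_ge_0 (f (RtoC 0))).
assert (T := Cmod_triangle (Cminus (f z) (f (RtoC 0))) (f (RtoC 0))).
replace (Cplus (Cminus (f z) (f (RtoC 0))) (f (RtoC 0))) with (f z) in T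
  by ring.
assert (I := Rinv_0_lt_compat _ W).
unfold in_disc in Hz; assert (Pz := Cmod_ge_0 z).
set (i := / (1 - Cmod z ^ 2)) in *.
set (b := real (bloch_seminorm f)) in *.
unfold Rdiv in L; fold i in L.
assert (0 <= b * i) by (apply Rmult_le_pos; lra).
assert (b * i * Cmod z <= b * i) by nra.
assert (0 <= Cmod (f (RtoC 0)) * i) by (apply Rmult_le_pos; lra).
lra.
Qed.

Lemma B0_norm_eq_0 f : B0_norm f = 0 -> f = B0_zero.
Proof.
intros H; apply B0_ext; intros z Hz; simpl.
apply Cmod_eq_0.
assert (L := B0_value_le f z Hz); rewrite H, Rmult_0_l in L.
assert (P := Cmod_ge_0 (f z)); lra.
Qed.

Lemma B0_norm_ge0 f : 0 <= B0_norm f.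
Proof. apply bloch_norm_ge0. Qed.

Lemma B0_norm_zero : B0_norm B0_zero = 0.
Proof.
replace B0_zero with (B0_scal (RtoC 0) B0_zero)
  by (apply B0_ext; intros; simpl; ring).
assert (H := B0_norm_scal (RtoC 0) B0_zero).
rewrite Cmod_0, Rmult_0_l in H.
assert (P := B0_norm_ge0 (B0_scal (RtoC 0) B0_zero)); lra.
Qed.

Definition B0_AbelianMonoid_mixin : AbelianMonoid.mixin_of B0.
Proof.
exists B0_plus B0_zero.
- abstract (intros; apply B0_ext; intros; apply Cplus_comm).
- abstract (intros; apply B0_ext; intros; apply Cplus_assoc).
- abstract (intros; apply B0_ext; intros; apply Cplus_0_r).
Defined.

Canonical B0_AbelianMonoid := AbelianMonoid.Pack B0 B0_AbelianMonoid_mixin B0.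

Definition B0_AbelianGroup_mixin : AbelianGroup.mixin_of B0_AbelianMonoid.
Proof.
exists B0_opp.
abstract (intros; apply B0_ext; intros; simpl; ring).
Defined.

Canonical B0_AbelianGroup :=
  AbelianGroup.Pack B0
    (AbelianGroup.Class B0 B0_AbelianMonoid_mixin B0_AbelianGroup_mixin) B0.

Definition B0_ModuleSpace_mixin : ModuleSpace.mixin_of C_Ring B0_AbelianGroup.
Proof.
exists B0_scal;
  abstract (intros; apply B0_ext; intros; simpl;
    unfold plus, mult, one; simpl; ring).
Defined.

Canonical B0_ModuleSpace :=
  ModuleSpace.Pack C_Ring B0
    (ModuleSpace.Class C_Ring B0 (AbelianGroup.class B0_AbelianGroup)
      B0_ModuleSpace_mixin) B0.

Definition B0_dist (f g : B0) : R := B0_norm (minus g f).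

Lemma B0_dist_refl f : B0_dist f f = 0.
Proof. unfold B0_dist; rewrite minus_eq_zero; apply B0_norm_zero. Qed.

Lemma B0_dist_sym_le f g : B0_dist g f <= B0_dist f g.
Proof.
unfold B0_dist.
replace (minus f g) with (B0_scal (RtoC (-1)) (minus g f)).
- assert (H := B0_norm_scal (RtoC (-1)) (minus g f)).
  rewrite Cmod_R, Rabs_left in H by lra; lra.
- rewrite <- (opp_minus g f); reflexivity.
Qed.

Lemma B0_dist_triangle f g h : B0_dist f h <= B0_dist f g + B0_dist g h.
Proof.
unfold B0_dist; rewrite (minus_trans g h f), Rplus_comm.
apply (B0_norm_triangle (minus h g) (minus g f)).
Qed.

Definition B0_UniformSpace_mixin : UniformSpace.mixin_of B0.
Proof.
refine (UniformSpace.Mixin B0 B0_zero (fun f eps g => B0_dist f g < eps) _ _ _).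
- abstract (intros f e; rewrite B0_dist_refl; apply cond_pos).
- abstract (intros f g e; apply Rle_lt_trans; apply B0_dist_sym_le).
- abstract (intros f g h e1 e2 H1 H2;
    apply Rle_lt_trans with (1 := B0_dist_triangle f g h); lra).
Defined.

Canonical B0_UniformSpace := UniformSpace.Pack B0 B0_UniformSpace_mixin B0.

Canonical B0_NormedModuleAux :=
  NormedModuleAux.Pack C_AbsRing B0
    (NormedModuleAux.Class C_AbsRing B0 (ModuleSpace.class _ B0_ModuleSpace)
      (UniformSpace.class B0_UniformSpace)) B0.

Definition B0_NormedModule_mixin :
  NormedModule.mixin_of C_AbsRing B0_NormedModuleAux.
Proof.
exists B0_norm 1.
- exact B0_norm_triangle.
- exact B0_norm_scal.
- intros f g eps H; exact H.
- intros f g eps H; rewrite Rmult_1_l; exact H.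
- exact B0_norm_eq_0.
Defined.

Canonical B0_NormedModule :=
  NormedModule.Pack C_AbsRing B0
    (NormedModule.Class C_AbsRing B0
      (NormedModuleAux.class _ B0_NormedModuleAux) B0_NormedModule_mixin) B0.

Lemma B0_ball (f g : B0) eps : ball f eps g = (B0_norm (minus g f) < eps).
Proof. reflexivity. Qed.

Lemma B0_minus_apply (f g : B0) z : minus f g z = Cminus (f z) (g z).
Proof.
change (Cplus (f z) (Cmult (RtoC (-1)) (g z)) = Cminus (f z) (g z)).
replace (RtoC (-1)) with (Copp (RtoC 1)) by (now rewrite <- RtoC_opp).
ring.
Qed.

Lemma B0_derive_minus (f g : B0) z : in_disc z ->
  C_derive (minus f g) z = Cminus (C_derive f z) (C_derive g z).
Proof.
intros Hz.
apply is_C_derive_unique.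
apply is_derive_ext with (fun w => @minus C_NormedModule (f w) (g w)).
- intros w; symmetry; apply B0_minus_apply.
- apply (@is_derive_minus C_AbsRing C_NormedModule);
    apply is_derive_C_derive; trivial; apply B0_little_bloch.
Qed.

Lemma B0_weight_le (f : B0) z : in_disc z -> bloch_weight f z <= B0_norm f.
Proof.
intros Hz.
apply Rle_trans with (1 := bloch_weight_le f z (proj1 (B0_little_bloch f)) Hz).
unfold B0_norm, bloch_norm; assert (P := Cmod_ge_0 (f (RtoC 0))); lra.
Qed.

Lemma Cmod_le_of_cluster (a : C) (M : R) :
  (forall d : R, 0 < d -> exists b : C, Cmod (Cminus b a) < d /\ Cmod b <= M) ->
  Cmod a <= M.
Proof.
intros H; apply le_epsilon; intros d Hd.
destruct (H d Hd) as [b [H1 H2]].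
assert (T := Cmod_triangle b (Cminus a b)).
replace (Cplus b (Cminus a b)) with a in T by ring.
replace (Cminus a b) with (Copp (Cminus b a)) in T by ring.
rewrite Cmod_opp in T; lra.
Qed.

Section Completeness.

Variable F : (B0 -> Prop) -> Prop.
Hypothesis FF : ProperFilter F.
Hypothesis FC : cauchy F.

Lemma filter_lim_C (e : B0 -> C) (K : R) :
  (forall f g, Cmod (Cminus (e g) (e f)) <= K * B0_norm (minus g f)) ->
  exists l : C, forall d : R, 0 < d -> F (fun f => Cmod (Cminus (e f) l) < d).
Proof.
intros H.
assert (HK : 0 < Rabs K + 1) by (assert (P := Rabs_pos K); lra).
assert (PG : ProperFilter (filtermap e F)) by now apply filtermap_proper_filter.
assert (CG : @cauchy C_UniformSpace (filtermap e F)).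
{ intros eps.
  assert (He : 0 < eps / (Rabs K + 1))
    by (apply Rdiv_lt_0_compat; [apply cond_pos | exact HK]).
  destruct (FC (mkposreal _ He)) as [f Hf].
  exists (e f); unfold filtermap.
  revert Hf; apply filter_imp; intros g Hg.
  rewrite B0_ball in Hg; simpl in Hg.
  apply (@norm_compat1 C_AbsRing C_NormedModule).
  change (Cmod (Cminus (e g) (e f)) < eps).
  apply Rle_lt_trans with (1 := H f g).
  assert (P := B0_norm_ge0 (minus g f)).
  assert (KA := Rle_abs K).
  apply Rle_lt_trans with ((Rabs K + 1) * B0_norm (minus g f)); [nra|].
  replace (pos eps) with ((Rabs K + 1) * (eps / (Rabs K + 1)))
    by (field; lra).
  now apply Rmult_lt_compat_l. }
exists (lim (filtermap e F : (C_CompleteNormedModule -> Prop) -> Prop)).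
intros d Hd.
assert (Hd' : 0 < d / sqrt 2)
  by (apply Rdiv_lt_0_compat; [lra | apply sqrt_lt_R0; lra]).
assert (L := @complete_cauchy C_CompleteNormedModule _ PG CG (mkposreal _ Hd')).
unfold filtermap in L.
revert L; apply filter_imp; intros f Hf.
apply (@norm_compat2 C_AbsRing C_NormedModule) in Hf.
set (l := lim _) in *.
change (Cmod (Cminus (e f) l) < sqrt 2 * (d / sqrt 2)) in Hf.
replace (sqrt 2 * (d / sqrt 2)) with d in Hf; [exact Hf|].
field; apply Rgt_not_eq, sqrt_lt_R0; lra.
Qed.

Lemma value_lim (z : C) : in_disc z -> exists l : C,
  forall d : R, 0 < d -> F (fun f => Cmod (Cminus (f z) l) < d).
Proof.
intros Hz; apply filter_lim_C with (K := 1 + / (1 - Cmod z ^ 2)).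
intros f g; rewrite <- B0_minus_apply, Rmult_comm; now apply B0_value_le.
Qed.

Lemma derive_lim (z : C) : in_disc z -> exists l : C,
  forall d : R, 0 < d -> F (fun f => Cmod (Cminus (C_derive f z) l) < d).
Proof.
intros Hz; assert (W := weight_pos z Hz).
apply (filter_lim_C (fun f => C_derive f z)) with (K := / (1 - Cmod z ^ 2)).
intros f g; rewrite <- B0_derive_minus by exact Hz.
assert (B := B0_weight_le (minus g f) z Hz); unfold bloch_weight in B.
apply Rmult_le_reg_l with (1 := W).
apply Rle_trans with (1 := B).
rewrite <- Rmult_assoc, Rinv_r by lra; lra.
Qed.

Lemma filter_pick (P Q : B0 -> Prop) : F P -> F Q -> exists f, P f /\ Q f.
Proof. intros HP HQ; apply filter_ex; now apply filter_and. Qed.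

Lemma B0_lim_exists : exists f : B0, forall eps : posreal, F (ball f eps).
Proof.
destruct (choice (fun (z : C) (l : C * C) =>
  (in_disc z -> forall d : R, 0 < d ->
     F (fun f => Cmod (Cminus (f z) (fst l)) < d) /\
     F (fun f => Cmod (Cminus (C_derive f z) (snd l)) < d)) /\
  (~ in_disc z -> fst l = RtoC 0))) as [p Hp].
{ intros z; destruct (Rlt_dec (Cmod z) 1) as [L|L].
  - destruct (value_lim z L) as [a Ha]; destruct (derive_lim z L) as [b Hb].
    exists (a, b); split; [|intros N; now contradiction].
    intros _ d Hd; split; [now apply Ha | now apply Hb].
  - exists (RtoC 0, RtoC 0); split; [intros N; now contradiction | reflexivity]. }
set (f := fun z => fst (p z)); set (f' := fun z => snd (p z)).
assert (V : forall z, in_disc z -> forall d : R, 0 < d ->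
  F (fun h => Cmod (Cminus (h z) (f z)) < d)) by (intros; now apply Hp).
assert (V' : forall z, in_disc z -> forall d : R, 0 < d ->
  F (fun h => Cmod (Cminus (C_derive h z) (f' z)) < d))
  by (intros; now apply Hp).
assert (O : forall z, ~ in_disc z -> f z = RtoC 0) by (intros; now apply Hp).
clearbody f f'; clear p Hp.
assert (A0 : forall (h : B0) eps, F (ball h eps) ->
  Cmod (Cminus (f (RtoC 0)) (h (RtoC 0))) <= eps).
{ intros h eps Hh; apply Cmod_le_of_cluster; intros d Hd.
  destruct (filter_pick _ _ Hh (V _ in_disc_0 d Hd)) as [k [K1 K2]].
  exists (Cminus (k (RtoC 0)) (h (RtoC 0))); split.
  - replace (Cminus _ _) with (Cminus (k (RtoC 0)) (f (RtoC 0))) by ring.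
    exact K2.
  - rewrite B0_ball in K1; rewrite <- B0_minus_apply; left.
    apply Rle_lt_trans with (2 := K1); unfold B0_norm, bloch_norm.
    assert (P := real_bloch_seminorm_ge0 (minus k h)); lra. }
assert (A1 : forall (h : B0) eps z, F (ball h eps) -> in_disc z ->
  (1 - Cmod z ^ 2) * Cmod (Cminus (f' z) (C_derive h z)) <= eps).
{ intros h eps z Hh Hz; assert (W := weight_pos z Hz).
  apply Rmult_le_reg_l with (1 := Rinv_0_lt_compat _ W).
  rewrite <- Rmult_assoc, Rinv_l, Rmult_1_l by lra.
  apply Cmod_le_of_cluster; intros d Hd.
  destruct (filter_pick _ _ Hh (V' _ Hz d Hd)) as [k [K1 K2]].
  exists (Cminus (C_derive k z) (C_derive h z)); split.
  - replace (Cminus _ _) with (Cminus (C_derive k z) (f' z)) by ring.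
    exact K2.
  - rewrite B0_ball in K1; rewrite <- B0_derive_minus by exact Hz.
    apply Rmult_le_reg_l with (1 := W).
    rewrite <- Rmult_assoc, Rinv_r, Rmult_1_l by lra.
    left; apply Rle_lt_trans with (2 := K1).
    exact (B0_weight_le (minus k h) z Hz). }
assert (A2 : forall (h : B0) eps r z w, F (ball h eps) -> r < 1 ->
  Cmod z <= r -> Cmod w <= r ->
  Cmod (Cminus (Cminus (f w) (h w)) (Cminus (f z) (h z)))
    <= eps / (1 - r ^ 2) * Cmod (Cminus w z)).
{ intros h eps r z w Hh Hr Hz Hw.
  assert (P0 := Cmod_ge_0 z).
  assert (W : 0 < 1 - r ^ 2) by nra.
  apply Cmod_le_of_cluster; intros d Hd.
  assert (Dz : in_disc z) by (unfold in_disc; lra).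
  assert (Dw : in_disc w) by (unfold in_disc; lra).
  assert (Hd2 : 0 < d / 2) by lra.
  destruct (filter_pick _ _ Hh (filter_and _ _ (V _ Dz _ Hd2) (V _ Dw _ Hd2)))
    as [k [K1 [K2 K3]]].
  exists (Cminus (Cminus (k w) (h w)) (Cminus (k z) (h z))); split.
  - replace (Cminus _ _) with
      (Cplus (Cminus (k w) (f w)) (Copp (Cminus (k z) (f z)))) by ring.
    apply Rle_lt_trans with (1 := Cmod_triangle _ _).
    rewrite Cmod_opp; lra.
  - rewrite B0_ball in K1; rewrite <- !B0_minus_apply.
    apply Rle_trans with (1 := bloch_lipschitz (minus k h) z w r
      (proj1 (B0_little_bloch _)) Hr Hz Hw).
    apply Rmult_le_compat_r; [apply Cmod_ge_0|].
    apply Rmult_le_compat_r; [left; now apply Rinv_0_lt_compat|].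
    left; apply Rle_lt_trans with (2 := K1); unfold B0_norm, bloch_norm.
    assert (P := Cmod_ge_0 (minus k h (RtoC 0))); lra. }
assert (D : forall z, in_disc z ->
  @is_derive C_AbsRing C_NormedModule f z (f' z)).
{ intros z Hz; split; [apply is_linear_scal_l|].
  intros x Hx.
  rewrite <- (is_filter_lim_locally_unique _ _ Hx); clear x Hx.
  intros eps.
  set (r := (1 + Cmod z) / 2).
  unfold in_disc in Hz; assert (Pz := Cmod_ge_0 z).
  assert (Hr : Cmod z < r < 1) by (unfold r; lra).
  assert (W : 0 < 1 - r ^ 2) by nra.
  assert (We : 0 < (1 - r ^ 2) * (eps / 3))
    by (assert (P := cond_pos eps); nra).
  destruct (FC (mkposreal _ We)) as [h Hh].
  destruct (is_derive_C_derive h z (proj1 (proj1 (B0_little_bloch h))) Hz)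
    as [_ Dh].
  assert (He3 : 0 < eps / 3) by (assert (P := cond_pos eps); lra).
  specialize (Dh _ (fun P H => H) (mkposreal _ He3)).
  destruct Dh as [s Hs].
  assert (Hs' : 0 < Rmin s (r - Cmod z))
    by (apply Rmin_pos; [apply cond_pos | lra]).
  exists (mkposreal _ Hs'); intros w Hw.
  change C in (type of w).
  change (Cmod (Cminus w z) < Rmin s (r - Cmod z)) in Hw.
  specialize (Hs w).
  change (Cmod (Cminus w z) < s ->
    Cmod (Cminus (Cminus (h w) (h z)) (Cmult (Cminus w z) (C_derive h z)))
      <= eps / 3 * Cmod (Cminus w z)) in Hs.
  change (Cmod (Cminus (Cminus (f w) (f z)) (Cmult (Cminus w z) (f' z)))
    <= eps * Cmod (Cminus w z)).
  specialize (Hs (Rlt_le_trans _ _ _ Hw (Rmin_l _ _))).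
  assert (Hwr : Cmod w <= r).
  { assert (T := Cmod_triangle (Cminus w z) z).
    replace (Cplus (Cminus w z) z) with w in T by ring.
    assert (M := Rmin_r s (r - Cmod z)); lra. }
  assert (B2 := A2 h _ r z w Hh (proj2 Hr) (Rlt_le _ _ (proj1 Hr)) Hwr).
  assert (B1 := A1 h _ z Hh Hz).
  cbn [pos] in B1, B2.
  replace ((1 - r ^ 2) * (eps / 3) / (1 - r ^ 2))
    with (eps / 3) in B2 by (field; apply Rgt_not_eq; exact W).
  assert (B1' : Cmod (Cminus (f' z) (C_derive h z)) <= eps / 3).
  { apply Rmult_le_reg_l with (1 := W).
    apply Rle_trans with (2 := B1).
    apply Rmult_le_compat_r; [apply Cmod_ge_0|]; nra. }
  replace (Cminus (Cminus (f w) (f z)) (Cmult (Cminus w z) (f' z))) with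
    (Cplus (Cplus (Cminus (Cminus (f w) (h w)) (Cminus (f z) (h z)))
      (Cminus (Cminus (h w) (h z)) (Cmult (Cminus w z) (C_derive h z))))
      (Copp (Cmult (Cminus w z) (Cminus (f' z) (C_derive h z))))) by ring.
  apply Rle_trans with (1 := Cmod_triangle _ _).
  rewrite Cmod_opp, Cmod_mult.
  assert (T := Cmod_triangle (Cminus (Cminus (f w) (h w)) (Cminus (f z) (h z)))
    (Cminus (Cminus (h w) (h z)) (Cmult (Cminus w z) (C_derive h z)))).
  assert (Pw := Cmod_ge_0 (Cminus w z)).
  assert (Cmod (Cminus w z) * Cmod (Cminus (f' z) (C_derive h z))
    <= Cmod (Cminus w z) * (eps / 3)) by now apply Rmult_le_compat_l.
  lra. }
assert (Hol : holomorphic_on_disc f)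
  by (intros z Hz; exists (f' z); now apply D).
assert (Ed : forall z, in_disc z -> C_derive f z = f' z)
  by (intros z Hz; apply is_C_derive_unique; now apply D).
assert (A3 : forall (h : B0) eps z, F (ball h eps) -> in_disc z ->
  bloch_weight f z <= bloch_weight h z + eps).
{ intros h eps z Hh Hz; unfold bloch_weight; rewrite (Ed z Hz).
  assert (B := A1 h eps z Hh Hz); assert (W := weight_pos z Hz).
  assert (T := Cmod_triangle (C_derive h z) (Cminus (f' z) (C_derive h z))).
  replace (Cplus (C_derive h z) (Cminus (f' z) (C_derive h z))) with (f' z)
    in T by ring.
  nra. }
assert (LB : little_bloch f).
{ split.
  - destruct (FC (mkposreal 1 Rlt_0_1)) as [h Hh].
    apply bloch_intro with (B0_norm h + 1); [exact Hol|].
    intros z Hz; apply Rle_trans with (1 := A3 h _ z Hh Hz); simpl.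
    apply Rplus_le_compat_r; now apply B0_weight_le.
  - intros eps He; assert (He2 : 0 < eps / 2) by lra.
    destruct (FC (mkposreal _ He2)) as [h Hh].
    destruct (proj2 (B0_little_bloch h) _ He2) as [r [Hr1 Hr2]].
    exists r; split; [exact Hr1|]; intros z Hz.
    assert (B := A3 h _ z Hh (proj2 Hz)); simpl in B.
    assert (B' := Hr2 z Hz); lra. }
exists (mkB0 f LB O); intros eps.
assert (He4 : 0 < eps / 4) by (assert (P := cond_pos eps); lra).
destruct (FC (mkposreal _ He4)) as [h Hh].
generalize Hh; apply filter_imp; intros k Hk.
assert (N : B0_dist (mkB0 f LB O) h <= eps / 2).
{ apply Rle_trans with (1 := B0_dist_sym_le _ _).
  unfold B0_dist, B0_norm, bloch_norm.
  rewrite B0_minus_apply; cbn [B0_fun].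
  assert (B0' := A0 h _ Hh); simpl in B0'.
  assert (Q : real (bloch_seminorm (minus (mkB0 f LB O) h)) <= eps / 4).
  { apply real_bloch_seminorm_le; intros z Hz; unfold bloch_weight.
    rewrite B0_derive_minus by exact Hz; simpl B0_fun; rewrite (Ed z Hz).
    exact (A1 h _ z Hh Hz). }
  lra. }
change (B0_dist (mkB0 f LB O) k < eps).
change (B0_dist h k < eps / 4) in Hk.
apply Rle_lt_trans with (1 := B0_dist_triangle _ h _).
assert (P := cond_pos eps); lra.
Qed.

End Completeness.

Definition B0_lim (F : (B0 -> Prop) -> Prop) : B0 :=
  epsilon (inhabits B0_zero) (fun f => forall eps : posreal, F (ball f eps)).

Definition B0_CompleteSpace_mixin : CompleteSpace.mixin_of B0_UniformSpace.
Proof.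
exists B0_lim.
- intros F FF FC; unfold B0_lim; apply epsilon_spec.
  now apply B0_lim_exists.
- intros F1 F2 H12 H21.
  replace F2 with F1; [apply close_refl|].
  apply functional_extensionality; intros P.
  apply propositional_extensionality; split; [apply H21 | apply H12].
Defined.

Canonical B0_CompleteSpace :=
  CompleteSpace.Pack B0
    (CompleteSpace.Class B0 B0_UniformSpace_mixin B0_CompleteSpace_mixin) B0.

Canonical B0_CompleteNormedModule :=
  CompleteNormedModule.Pack C_AbsRing B0
    (CompleteNormedModule.Class C_AbsRing B0
      (NormedModule.class _ B0_NormedModule) B0_CompleteSpace_mixin) B0.

Definition dense {T : UniformSpace} (A : T -> Prop) : Prop :=
  forall (x : T) (P : T -> Prop), locally x P -> exists y : T, A y /\ P y.

Definition hypercyclic {X : CompleteNormedModule C_AbsRing} (T : X -> X)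
  : Prop :=
  exists f : X, dense (fun g : X => exists n : nat, g = Nat.iter n T f).

(* [T] is the restriction of the composition operator [f |-> f o phi] to the
   little Bloch space; in particular that space is invariant under it. *)
Definition is_composition_operator (phi : C -> C) (T : B0 -> B0) : Prop :=
  forall (f : B0) (z : C), in_disc z -> T f z = f (phi z).

(* Main.v *)
Require Import Defs.
From Stdlib Require Import Reals Lra Psatz ClassicalEpsilon.
From Coquelicot Require Import Coquelicot.
Open Scope R_scope.

(** [lambda C_phi] does not increase the Bloch seminorm, so the seminorm is
    bounded along each orbit.  The reason is the Schwarz-Pick inequality
    [schwarz_pick], [(1 - |z|^2) |phi'(z)| <= 1 - |phi(z)|^2]: it bounds the
    Bloch weight of [lambda (f o phi)] at [z] by the weight of [f] at [phi z]
    ([weighted_composition_contracts]).  Hence every element of the orbit of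
    [f] has seminorm at most [M = ||f||_B], and the orbit stays at distance at
    least 1 from the function [(M + 1) z].

    The substance is Schwarz-Pick for functions which are merely
    differentiable at each point.  Conjugating by disc automorphisms reduces
    it to [|F'(0)| <= 1] for a self-map [F] fixing 0 ([schwarz_derivative]).
    There [F'(0)] is the limit, as [r] tends to 0, of the mean of [F(z)/z] over
    the circle of radius [r]; this mean does not depend on [r], and it is
    bounded by [1/r], which tends to 1 as [r] tends to 1.

    Independence of the radius is Cauchy's theorem on a rectangle, in the
    coordinates [z = exp (x + i y)], where circles become vertical segments of
    length [2 pi] and the two horizontal sides cancel by periodicity.  The
    imaginary part of Cauchy's theorem is the case [P = Im h], [Q = Re h] of a
    statement on real forms: if [P] and [Q] are differentiable with
    [P_y = Q_x], then [P dx + Q dy] has circulation 0 along every rectangle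
    ([circulation_eq_0]).  Continuity of the partial
    derivatives is not known beforehand, so this is proved by Goursat's
    repeated bisection. *)

(** * Repeated bisection of a rectangle *)

Definition half (i j : R * R) : Prop :=
  j = (fst i, (fst i + snd i) / 2) \/ j = ((fst i + snd i) / 2, snd i).

Definition sub_interval (j i : R * R) : Prop :=
  fst i <= fst j /\ snd j <= snd i.

Lemma nested_halves (i : nat -> R * R) :
  fst (i O) <= snd (i O) -> (forall n, half (i n) (i (S n))) ->
  exists x, (forall n, fst (i n) <= x <= snd (i n)) /\
    (forall n, sub_interval (i n) (i O)) /\
    (forall d, 0 < d -> exists N, forall n, (N <= n)%nat ->
       snd (i n) - fst (i n) < d).
Proof.
intros H0 H.
assert (L : forall n, snd (i n) - fst (i n) = (snd (i O) - fst (i O)) * (/ 2) ^ n).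
{ induction n as [|n IH]; [simpl; ring|].
  assert (E : snd (i (S n)) - fst (i (S n)) = (snd (i n) - fst (i n)) / 2)
    by (destruct (H n) as [-> | ->]; simpl; field).
  rewrite E, IH; simpl; field. }
assert (Lp : forall n, fst (i n) <= snd (i n)).
{ intros n; assert (0 <= (/ 2) ^ n) by (apply pow_le; lra).
  specialize (L n); nra. }
assert (M : forall n k, sub_interval (i (n + k)%nat) (i n)).
{ intros n k; unfold sub_interval; induction k as [|k IH].
  - rewrite Nat.add_0_r; lra.
  - rewrite Nat.add_succ_r.
    specialize (Lp (n + k)%nat).
    destruct (H (n + k)%nat) as [-> | ->]; simpl; lra. }
assert (X : forall n m, fst (i n) <= snd (i m)).
{ intros n m.
  destruct (Nat.le_ge_cases n m) as [K|K].
  - replace m with (n + (m - n))%nat by lia.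
    specialize (M n (m - n)%nat); specialize (Lp (n + (m - n))%nat).
    unfold sub_interval in M; lra.
  - replace n with (m + (n - m))%nat by lia.
    specialize (M m (n - m)%nat); specialize (Lp (m + (n - m))%nat).
    unfold sub_interval in M; lra. }
destruct (completeness (fun r => exists n, r = fst (i n))) as [x [U V]].
- exists (snd (i O)); intros r [n ->]; apply X.
- now exists (fst (i O)), O.
- exists x; split; [|split].
  + intros n; split; [apply U; now exists n|].
    apply V; intros r [m ->]; apply X.
  + intros n; apply (M O n).
  + intros d Hd.
    set (l := snd (i O) - fst (i O)) in *.
    assert (Hl : 0 < d / (l + 1)) by (apply Rdiv_lt_0_compat; unfold l; lra).
    destruct (pow_lt_1_zero (/ 2)) with (y := d / (l + 1)) as [N HN].
    * rewrite Rabs_pos_eq; lra.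
    * exact Hl.
    * exists N; intros n Hn; rewrite L.
      specialize (HN n Hn).
      assert (0 <= (/ 2) ^ n) by (apply pow_le; lra).
      rewrite Rabs_pos_eq in HN by assumption.
      apply Rle_lt_trans with ((l + 1) * (/ 2) ^ n); [nra|].
      replace d with ((l + 1) * (d / (l + 1))) by (field; unfold l; lra).
      apply Rmult_lt_compat_l; [unfold l; lra | exact HN].
Qed.

(** Goursat's argument in abstract form: a defect which every rectangle passes
    on to one of its quarters accumulates at some point. *)
Lemma rectangle_bisection (B : R * R -> R * R -> Prop) (i j : R * R) :
  (forall i j, B i j -> exists i' j', half i i' /\ half j j' /\ B i' j') ->
  fst i <= snd i -> fst j <= snd j -> B i j ->
  exists x y, fst i <= x <= snd i /\ fst j <= y <= snd j /\
    forall d, 0 < d -> exists i' j',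
      sub_interval i' i /\ sub_interval j' j /\
      fst i' <= x <= snd i' /\ fst j' <= y <= snd j' /\
      snd i' - fst i' < d /\ snd j' - fst j' < d /\ B i' j'.
Proof.
intros H Hi Hj HB.
set (T := {p : (R * R) * (R * R) | B (fst p) (snd p)}).
destruct (choice (fun p q : T =>
  half (fst (proj1_sig p)) (fst (proj1_sig q)) /\
  half (snd (proj1_sig p)) (snd (proj1_sig q)))) as [s Hs].
{ intros [[a b] Hp]; simpl in Hp.
  destruct (H a b Hp) as [a' [b' [Ha [Hb Hp']]]].
  now exists (exist (fun p => B (fst p) (snd p)) (a', b') Hp'). }
set (p := fun n => Nat.iter n s
  (exist (fun p => B (fst p) (snd p)) (i, j) HB : T)).
destruct (nested_halves (fun n => fst (proj1_sig (p n)))) as [x [X1 [X2 X3]]];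
  [exact Hi | intros n; apply (Hs (p n)) |].
destruct (nested_halves (fun n => snd (proj1_sig (p n)))) as [y [Y1 [Y2 Y3]]];
  [exact Hj | intros n; apply (Hs (p n)) |].
exists x, y; split; [apply (X1 O) | split; [apply (Y1 O)|]].
intros d Hd.
destruct (X3 d Hd) as [N HN]; destruct (Y3 d Hd) as [N' HN'].
set (n := max N N').
exists (fst (proj1_sig (p n))), (snd (proj1_sig (p n))).
repeat split; try apply X2; try apply Y2; try apply X1; try apply Y1.
- apply HN; unfold n; lia.
- apply HN'; unfold n; lia.
- apply (proj2_sig (p n)).
Qed.

(** * Circulation of a closed form *)

(** The anticlockwise integral of [P dx + Q dy] along the boundary of the
    rectangle [i x j], with opposite sides already paired. *)
Definition circulation (P Q : R -> R -> R) (i j : R * R) : R :=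
  RInt (fun x => P x (fst j) - P x (snd j)) (fst i) (snd i) +
  RInt (fun y => Q (snd i) y - Q (fst i) y) (fst j) (snd j).

(** The form [P dx + Q dy] is closed at a point when the shared coefficient [l]
    below is both [P_y] and [Q_x]. *)
Definition closed_form_at (P Q : R -> R -> R) (x y : R) : Prop :=
  exists k l m, differentiable_pt_lim P x y k l /\
    differentiable_pt_lim Q x y l m.

Definition closed_form_on (P Q : R -> R -> R) (i j : R * R) : Prop :=
  forall x y, fst i <= x <= snd i -> fst j <= y <= snd j ->
    closed_form_at P Q x y.

Lemma differentiable_continuous_1 (f : R -> R -> R) x y k l :
  differentiable_pt_lim f x y k l -> continuous (fun t => f t y) x.
Proof.
intros H.
assert (D : derivable_pt_lim (fun t => f t y) x (k * 1 + l * 0)).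
{ apply (derivable_pt_lim_comp_2d f (fun t => t) (fun _ => y)).
  - exact H.
  - apply derivable_pt_lim_id.
  - apply derivable_pt_lim_const. }
apply (@ex_derive_continuous R_AbsRing R_NormedModule).
eexists; apply is_derive_Reals, D.
Qed.

Lemma differentiable_continuous_2 (f : R -> R -> R) x y k l :
  differentiable_pt_lim f x y k l -> continuous (fun t => f x t) y.
Proof.
intros H.
assert (D : derivable_pt_lim (fun t => f x t) y (k * 0 + l * 1)).
{ apply (derivable_pt_lim_comp_2d f (fun _ => x) (fun t => t)).
  - exact H.
  - apply derivable_pt_lim_const.
  - apply derivable_pt_lim_id. }
apply (@ex_derive_continuous R_AbsRing R_NormedModule).
eexists; apply is_derive_Reals, D.
Qed.

Lemma closed_form_ex_RInt_P P Q i j a b c d : closed_form_on P Q i j ->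
  a <= b -> sub_interval (a, b) i ->
  fst j <= c <= snd j -> fst j <= d <= snd j ->
  ex_RInt (fun x => P x c - P x d) a b.
Proof.
intros H Hab [S1 S2] Hc Hd; simpl in *.
apply (@ex_RInt_continuous R_CompleteNormedModule); rewrite Rmin_left, Rmax_right by lra.
intros x Hx.
destruct (H x c) as [k [l [m [D _]]]]; [lra | lra |].
destruct (H x d) as [k' [l' [m' [D' _]]]]; [lra | lra |].
apply (continuous_minus (fun x => P x c) (fun x => P x d)).
- now apply differentiable_continuous_1 with k l.
- now apply differentiable_continuous_1 with k' l'.
Qed.

Lemma closed_form_ex_RInt_Q P Q i j a b c d : closed_form_on P Q i j ->
  c <= d -> sub_interval (c, d) j ->
  fst i <= a <= snd i -> fst i <= b <= snd i ->
  ex_RInt (fun y => Q b y - Q a y) c d.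
Proof.
intros H Hab [S1 S2] Ha Hb; simpl in *.
apply (@ex_RInt_continuous R_CompleteNormedModule); rewrite Rmin_left, Rmax_right by lra.
intros y Hy.
destruct (H b y) as [k [l [m [_ D]]]]; [lra | lra |].
destruct (H a y) as [k' [l' [m' [_ D']]]]; [lra | lra |].
apply (continuous_minus (fun y => Q b y) (fun y => Q a y)).
- now apply differentiable_continuous_2 with l m.
- now apply differentiable_continuous_2 with l' m'.
Qed.

Lemma RInt_add (f g : R -> R) a b : ex_RInt f a b -> ex_RInt g a b ->
  RInt (fun x => f x + g x) a b = RInt f a b + RInt g a b.
Proof. exact (@RInt_plus R_CompleteNormedModule f g a b). Qed.

(** The circulation is additive: the integrals along the common side of two
    adjacent rectangles cancel. *)
Lemma circulation_split_x P Q a m b j : closed_form_on P Q (a, b) j ->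
  a <= m <= b -> fst j <= snd j ->
  circulation P Q (a, b) j = circulation P Q (a, m) j + circulation P Q (m, b) j.
Proof.
intros H Hm Hj; unfold circulation; simpl.
rewrite <- (RInt_Chasles (fun x => P x (fst j) - P x (snd j)) a m b).
- rewrite (RInt_ext (fun y => Q b y - Q a y)
    (fun y => (Q m y - Q a y) + (Q b y - Q m y))) by (intros; simpl; ring).
  rewrite RInt_add; [unfold plus; simpl; ring | |];
    apply closed_form_ex_RInt_Q with (1 := H); unfold sub_interval; simpl; lra.
- apply closed_form_ex_RInt_P with (1 := H); unfold sub_interval; simpl; lra.
- apply closed_form_ex_RInt_P with (1 := H); unfold sub_interval; simpl; lra.
Qed.

Lemma circulation_split_y P Q i c m d : closed_form_on P Q i (c, d) ->
  c <= m <= d -> fst i <= snd i ->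
  circulation P Q i (c, d) = circulation P Q i (c, m) + circulation P Q i (m, d).
Proof.
intros H Hm Hj; unfold circulation; simpl.
rewrite <- (RInt_Chasles (fun y => Q (snd i) y - Q (fst i) y) c m d).
- rewrite (RInt_ext (fun x => P x c - P x d)
    (fun x => (P x c - P x m) + (P x m - P x d))) by (intros; simpl; ring).
  rewrite RInt_add; [unfold plus; simpl; ring | |];
    apply closed_form_ex_RInt_P with (1 := H); unfold sub_interval;
    destruct i; simpl in *; lra.
- apply closed_form_ex_RInt_Q with (1 := H); unfold sub_interval; simpl; lra.
- apply closed_form_ex_RInt_Q with (1 := H); unfold sub_interval; simpl; lra.
Qed.

Lemma RInt_near_const f a b k M : a <= b -> ex_RInt f a b ->
  (forall x, a <= x <= b -> Rabs (f x - k) <= M) ->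
  Rabs (RInt f a b - (b - a) * k) <= (b - a) * M.
Proof.
intros Hab Hf H.
assert (Hk : ex_RInt (fun _ : R => k) a b) by apply ex_RInt_const.
replace (RInt f a b - (b - a) * k) with (RInt (fun x => minus (f x) k) a b).
- apply abs_RInt_le_const; [exact Hab | | exact H].
  now apply (ex_RInt_minus f (fun _ => k)).
- rewrite (RInt_minus f (fun _ => k)) by assumption.
  rewrite RInt_const; reflexivity.
Qed.

(** In the two paired integrals the first-order parts of [P] and [Q] contribute
    [- l] and [l] times the area, because [P_y = l = Q_x]; what is left comes
    from the remainders of the two first-order expansions. *)
Lemma circulation_small P Q x y e : closed_form_at P Q x y -> 0 < e ->
  exists d, 0 < d /\ forall i j, closed_form_on P Q i j ->
    fst i <= x <= snd i -> fst j <= y <= snd j ->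
    snd i - fst i < d -> snd j - fst j < d ->
    Rabs (circulation P Q i j)
      <= e * (snd i - fst i + (snd j - fst j)) ^ 2.
Proof.
intros [k [l [m [DP DQ]]]] He.
assert (He2 : 0 < e / 2) by lra.
destruct (DP (mkposreal _ He2)) as [d1 H1].
destruct (DQ (mkposreal _ He2)) as [d2 H2].
simpl in H1, H2.
exists (Rmin d1 d2); split; [apply Rmin_pos; apply cond_pos|].
intros [a b] [c d] HC; simpl; intros Hx Hy Hi Hj.
assert (Hi1 := Rlt_le_trans _ _ _ Hi (Rmin_l _ _)).
assert (Hi2 := Rlt_le_trans _ _ _ Hi (Rmin_r _ _)).
assert (Hj1 := Rlt_le_trans _ _ _ Hj (Rmin_l _ _)).
assert (Hj2 := Rlt_le_trans _ _ _ Hj (Rmin_r _ _)).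
set (s := b - a + (d - c)).
assert (A : forall u v, a <= u <= b -> c <= v <= d ->
  Rabs (u - x) <= b - a /\ Rabs (v - y) <= d - c).
{ intros u v Hu Hv; split; apply Rabs_le; lra. }
assert (Mx : forall u v, a <= u <= b -> c <= v <= d ->
  e / 2 * Rmax (Rabs (u - x)) (Rabs (v - y)) <= e / 2 * s).
{ intros u v Hu Hv; destruct (A u v Hu Hv).
  apply Rmult_le_compat_l; [lra|]; apply Rmax_lub; unfold s; lra. }
assert (EP : forall u, a <= u <= b ->
  Rabs ((P u c - P u d) - (- l * (d - c))) <= e * s).
{ intros u Hu.
  assert (B1 := H1 u c); assert (B2 := H1 u d).
  destruct (A u c) as [A1 A2]; [lra|lra|].
  destruct (A u d) as [_ A3]; [lra|lra|].
  specialize (B1 (Rle_lt_trans _ _ _ A1 Hi1) (Rle_lt_trans _ _ _ A2 Hj1)).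
  specialize (B2 (Rle_lt_trans _ _ _ A1 Hi1) (Rle_lt_trans _ _ _ A3 Hj1)).
  assert (M1 := Mx u c Hu ltac:(lra)); assert (M2 := Mx u d Hu ltac:(lra)).
  apply Rabs_le_between in B1; apply Rabs_le_between in B2.
  apply Rabs_le; lra. }
assert (EQ : forall v, c <= v <= d ->
  Rabs ((Q b v - Q a v) - (l * (b - a))) <= e * s).
{ intros v Hv.
  assert (B1 := H2 b v); assert (B2 := H2 a v).
  destruct (A b v) as [A1 A2]; [lra|lra|].
  destruct (A a v) as [A3 _]; [lra|lra|].
  specialize (B1 (Rle_lt_trans _ _ _ A1 Hi2) (Rle_lt_trans _ _ _ A2 Hj2)).
  specialize (B2 (Rle_lt_trans _ _ _ A3 Hi2) (Rle_lt_trans _ _ _ A2 Hj2)).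
  assert (M1 := Mx b v ltac:(lra) Hv); assert (M2 := Mx a v ltac:(lra) Hv).
  apply Rabs_le_between in B1; apply Rabs_le_between in B2.
  apply Rabs_le; lra. }
apply RInt_near_const in EP; [| lra |
  apply closed_form_ex_RInt_P with (1 := HC); unfold sub_interval; simpl; lra].
apply RInt_near_const in EQ; [| lra |
  apply closed_form_ex_RInt_Q with (1 := HC); unfold sub_interval; simpl; lra].
unfold circulation; simpl.
apply Rabs_le_between in EP; apply Rabs_le_between in EQ.
replace (e * (s * (s * 1))) with ((b - a) * (e * s) + (d - c) * (e * s))
  by (unfold s; ring).
apply Rabs_le; lra.
Qed.

Lemma closed_form_on_sub P Q i j i' j' : closed_form_on P Q i j ->
  sub_interval i' i -> sub_interval j' j -> closed_form_on P Q i' j'.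
Proof. intros H [] [] x y Hx Hy; apply H; lra. Qed.

(** A circulation exceeding [kappa] times the square of the half-perimeter does
    so on some quarter too, since the half-perimeter is halved and circulations
    add up.  At the accumulation point of these quarters this contradicts
    [circulation_small]. *)
Theorem circulation_eq_0 P Q i j : closed_form_on P Q i j ->
  fst i <= snd i -> fst j <= snd j -> circulation P Q i j = 0.
Proof.
intros H Hi Hj.
destruct (Req_dec (circulation P Q i j) 0) as [E|N]; [exact E | exfalso].
set (size := fun i j : R * R => snd i - fst i + (snd j - fst j)).
set (K := Rabs (circulation P Q i j)).
assert (PK : 0 < K) by (apply Rabs_pos_lt; exact N).
assert (Ps : 0 <= size i j) by (unfold size; lra).
set (kappa := K / (size i j ^ 2 + 1)).
assert (Pk : 0 < kappa) by (apply Rdiv_lt_0_compat; nra).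
set (B := fun i' j' => closed_form_on P Q i' j' /\ fst i' <= snd i' /\
  fst j' <= snd j' /\ kappa * size i' j' ^ 2 < Rabs (circulation P Q i' j')).
destruct (rectangle_bisection B i j) as [x [y [Hx [Hy Z]]]].
- intros [a b] [c d] (HC & Hab & Hcd & HK); simpl in Hab, Hcd.
  set (m := (a + b) / 2); set (n := (c + d) / 2).
  assert (Hm : a <= m <= b) by (unfold m; lra).
  assert (Hn : c <= n <= d) by (unfold n; lra).
  assert (E1 := circulation_split_x P Q a m b (c, d) HC Hm Hcd).
  assert (C1 : closed_form_on P Q (a, m) (c, d))
    by (apply closed_form_on_sub with (1 := HC); unfold sub_interval; simpl; lra).
  assert (C2 : closed_form_on P Q (m, b) (c, d))
    by (apply closed_form_on_sub with (1 := HC); unfold sub_interval; simpl; lra).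
  assert (E2 := circulation_split_y P Q (a, m) c n d C1 Hn (proj1 Hm)).
  assert (E3 := circulation_split_y P Q (m, b) c n d C2 Hn (proj2 Hm)).
  assert (G : forall i' j', half (a, b) i' -> half (c, d) j' ->
    Rabs (circulation P Q i' j') <= kappa * size (a, b) (c, d) ^ 2 / 4 \/
    B i' j').
  { intros i' j' Hi' Hj'.
    destruct (Rle_or_lt (Rabs (circulation P Q i' j'))
      (kappa * size (a, b) (c, d) ^ 2 / 4)) as [L|L]; [now left | right].
    unfold half in Hi', Hj'; simpl in Hi', Hj'.
    fold m in Hi'; fold n in Hj'.
    assert (Es : size i' j' = size (a, b) (c, d) / 2).
    { destruct Hi' as [-> | ->]; destruct Hj' as [-> | ->];
        unfold size, m, n; simpl; field. }
    split; [|split; [|split]].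
    - apply closed_form_on_sub with (1 := HC); unfold sub_interval;
        destruct Hi' as [-> | ->]; destruct Hj' as [-> | ->]; simpl; lra.
    - destruct Hi' as [-> | ->]; simpl; lra.
    - destruct Hj' as [-> | ->]; simpl; lra.
    - rewrite Es; apply Rle_lt_trans with (2 := L); apply Req_le; field. }
  assert (h1 : half (a, b) (a, m)) by now left.
  assert (h2 : half (a, b) (m, b)) by now right.
  assert (h3 : half (c, d) (c, n)) by now left.
  assert (h4 : half (c, d) (n, d)) by now right.
  destruct (G _ _ h1 h3) as [L1|?]; [|now exists (a, m), (c, n)].
  destruct (G _ _ h1 h4) as [L2|?]; [|now exists (a, m), (n, d)].
  destruct (G _ _ h2 h3) as [L3|?]; [|now exists (m, b), (c, n)].
  destruct (G _ _ h2 h4) as [L4|?]; [|now exists (m, b), (n, d)].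
  exfalso; apply (Rlt_not_le _ _ HK); rewrite E1, E2, E3.
  apply Rabs_le_between in L1; apply Rabs_le_between in L2.
  apply Rabs_le_between in L3; apply Rabs_le_between in L4.
  apply Rabs_le; lra.
- exact Hi.
- exact Hj.
- split; [exact H | split; [exact Hi | split; [exact Hj|]]].
  fold K; unfold kappa.
  replace K with (K / (size i j ^ 2 + 1) * (size i j ^ 2 + 1)) at 2
    by (field; nra).
  fold kappa; nra.
- destruct (circulation_small P Q x y kappa (H x y Hx Hy) Pk) as [d [Hd S]].
  destruct (Z d Hd) as (i' & j' & Si & Sj & Xi & Yj & Li & Lj & HB).
  destruct HB as (HC & _ & _ & HK).
  apply (Rlt_not_le _ _ HK), S; assumption.
Qed.

(** * Complex derivatives *)

Notation is_C_derive f z l := (@is_derive C_AbsRing C_NormedModule f z l).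

Lemma is_C_derive_eps (f : C -> C) (z l : C) :
  is_C_derive f z l <->
  forall e, 0 < e -> exists d, 0 < d /\ forall w, Cmod (Cminus w z) < d ->
    Cmod (Cminus (Cminus (f w) (f z)) (Cmult (Cminus w z) l))
      <= e * Cmod (Cminus w z).
Proof.
split.
- intros [_ D] e He.
  specialize (D _ (fun P H => H) (mkposreal _ He)).
  destruct D as [d Hd].
  exists d; split; [apply cond_pos | exact Hd].
- intros H; split; [apply is_linear_scal_l|].
  intros x Hx.
  rewrite <- (is_filter_lim_locally_unique _ _ Hx); clear x Hx.
  intros e; destruct (H e (cond_pos e)) as [d [Hd K]].
  exists (mkposreal d Hd); exact K.
Qed.

(** [C] carries two normed module structures over itself, with the same norm
    but different uniform structures; the lemmas on products and compositions
    of general derivatives are stated for the other one. *)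
Lemma is_C_derive_AbsRing (f : C -> C) (z l : C) :
  is_C_derive f z l <->
  @is_derive C_AbsRing (AbsRing_NormedModule C_AbsRing) f z l.
Proof. split; intros [_ D]; (split; [apply is_linear_scal_l | exact D]). Qed.

Lemma is_C_derive_mult (f g : C -> C) (z df dg : C) :
  is_C_derive f z df -> is_C_derive g z dg ->
  is_C_derive (fun w => Cmult (f w) (g w)) z
    (Cplus (Cmult df (g z)) (Cmult (f z) dg)).
Proof.
intros Hf Hg; apply is_C_derive_AbsRing in Hf, Hg; apply is_C_derive_AbsRing.
exact (@is_derive_mult C_AbsRing f g z df dg Hf Hg Cmult_comm).
Qed.

Lemma is_C_derive_comp (f g : C -> C) (z df dg : C) :
  is_C_derive f (g z) df -> is_C_derive g z dg ->
  is_C_derive (fun w => f (g w)) z (Cmult dg df).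
Proof.
intros Hf Hg; apply is_C_derive_AbsRing in Hg.
exact (@is_derive_comp C_AbsRing C_NormedModule f g z df dg Hf Hg).
Qed.

Lemma is_C_derive_id (z : C) : is_C_derive (fun w => w) z (RtoC 1).
Proof. apply is_C_derive_AbsRing; exact (@is_derive_id C_AbsRing z). Qed.

Lemma is_C_derive_affine (a b z : C) :
  is_C_derive (fun w => Cplus (Cmult a w) b) z a.
Proof.
apply is_C_derive_eps; intros e He; exists 1; split; [lra|].
intros w _.
replace (Cminus _ _) with (RtoC 0) by ring.
rewrite Cmod_0; assert (P := Cmod_ge_0 (Cminus w z)); nra.
Qed.

Lemma is_C_derive_inv (z : C) : z <> RtoC 0 ->
  is_C_derive Cinv z (Copp (Cinv (Cmult z z))).
Proof.
intros Hz; apply is_C_derive_eps; intros e He.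
assert (P := proj1 (Cmod_gt_0 z) Hz).
set (m := Cmod z) in *.
assert (Pm : 0 < m * m * m) by (apply Rmult_lt_0_compat; nra).
exists (Rmin (m / 2) (e * (m * m * m) / 2)); split.
{ apply Rmin_pos; nra. }
intros w Hw.
assert (W1 := Rlt_le_trans _ _ _ Hw (Rmin_l _ _)).
assert (W2 := Rlt_le_trans _ _ _ Hw (Rmin_r _ _)).
assert (T := Cmod_triangle w (Cminus z w)).
replace (Cplus w (Cminus z w)) with z in T by ring.
replace (Cminus z w) with (Copp (Cminus w z)) in T by ring.
rewrite Cmod_opp in T; fold m in T.
assert (Pw : m / 2 < Cmod w) by lra.
assert (Nw : w <> RtoC 0) by (apply Cmod_gt_0; lra).
replace (Cminus _ _) with
  (Cmult (Cmult (Cminus w z) (Cminus w z)) (Cinv (Cmult w (Cmult z z))))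
  by (field; split; assumption).
rewrite !Cmod_mult, Cmod_inv, !Cmod_mult;
  try (repeat apply Cmult_neq_0; assumption).
fold m; assert (Pd := Cmod_ge_0 (Cminus w z)).
set (d := Cmod (Cminus w z)) in *.
apply Rmult_le_reg_r with (Cmod w * (m * m)); [nra|].
rewrite Rmult_assoc, Rinv_l by (apply Rgt_not_eq; nra).
assert (m * m * m / 2 <= Cmod w * (m * m)) by nra.
assert (d <= e * (Cmod w * (m * m))) by nra.
nra.
Qed.

Lemma is_C_derive_div (f g : C -> C) (z df dg : C) : g z <> RtoC 0 ->
  is_C_derive f z df -> is_C_derive g z dg ->
  is_C_derive (fun w => Cdiv (f w) (g w)) z
    (Cdiv (Cminus (Cmult df (g z)) (Cmult (f z) dg)) (Cmult (g z) (g z))).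
Proof.
intros Hz Hf Hg.
assert (D := is_C_derive_mult _ _ _ _ _ Hf
  (is_C_derive_comp _ _ _ _ _ (is_C_derive_inv _ Hz) Hg)).
replace (Cdiv _ _) with (Cplus (Cmult df (Cinv (g z)))
  (Cmult (f z) (Cmult dg (Copp (Cinv (Cmult (g z) (g z))))))).
- exact D.
- field; exact Hz.
Qed.

(** * Real differentials and polar coordinates *)

Lemma Im_le_Cmod (z : C) : Rabs (Im z) <= Cmod z.
Proof. eapply Rle_trans; [apply Rmax_r | apply Rmax_Cmod]. Qed.

Lemma Cmod_le_2Rmax (z : C) :
  Cmod z <= 2 * Rmax (Rabs (fst z)) (Rabs (snd z)).
Proof.
apply Rle_trans with (1 := Cmod_2Rmax z).
apply Rmult_le_compat_r.
- apply Rle_trans with (2 := Rmax_l _ _); apply Rabs_pos.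
- rewrite <- (sqrt_square 2) at 2 by lra; apply sqrt_le_1_alt; lra.
Qed.

(** The common part of the next two lemmas, where [p] is [Re] or [Im]. *)
Lemma is_C_derive_differential (p : C -> R) (f : C -> C) (x y : R) (l : C) :
  (forall z, Rabs (p z) <= Cmod z) ->
  (forall z w, p (Cminus z w) = p z - p w) ->
  is_C_derive f (x, y) l ->
  forall e : posreal, locally_2d (fun u v =>
    Rabs (p (f (u, v)) - p (f (x, y)) - p (Cmult (u - x, v - y) l))
      <= e * Rmax (Rabs (u - x)) (Rabs (v - y))) x y.
Proof.
intros Hp1 Hp2 D e.
assert (He : 0 < e / 2) by (assert (P := cond_pos e); lra).
destruct (proj1 (is_C_derive_eps f (x, y) l) D _ He) as [d [Hd H]].
assert (Hd2 : 0 < d / 2) by lra.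
exists (mkposreal _ Hd2); simpl; intros u v Hu Hv.
specialize (H (u, v)).
replace (Cminus (u, v) (x, y)) with ((u - x, v - y) : C) in H by reflexivity.
assert (M := Cmod_le_2Rmax (u - x, v - y)); simpl in M.
assert (Mx : Rmax (Rabs (u - x)) (Rabs (v - y)) < d / 2)
  by now apply Rmax_lub_lt.
rewrite <- !Hp2.
apply Rle_trans with (1 := Hp1 _), Rle_trans with (1 := H ltac:(lra)).
nra.
Qed.

Lemma is_C_derive_Re (f : C -> C) (x y : R) (l : C) : is_C_derive f (x, y) l ->
  differentiable_pt_lim (fun u v => Re (f (u, v))) x y (Re l) (- Im l).
Proof.
intros D e.
destruct (is_C_derive_differential Re f x y l Re_le_Cmod
  (fun _ _ => eq_refl) D e) as [d H].
exists d; intros u v Hu Hv.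
replace (Re l * (u - x) + - Im l * (v - y)) with
  (Re (Cmult (u - x, v - y) l)) by (unfold Re, Im; simpl; ring).
now apply H.
Qed.

Lemma is_C_derive_Im (f : C -> C) (x y : R) (l : C) : is_C_derive f (x, y) l ->
  differentiable_pt_lim (fun u v => Im (f (u, v))) x y (Im l) (Re l).
Proof.
intros D e.
destruct (is_C_derive_differential Im f x y l Im_le_Cmod
  (fun _ _ => eq_refl) D e) as [d H].
exists d; intros u v Hu Hv.
replace (Im l * (u - x) + Re l * (v - y)) with
  (Im (Cmult (u - x, v - y) l)) by (unfold Re, Im; simpl; ring).
now apply H.
Qed.

Lemma differentiable_pt_lim_snd (f : R -> R) x y l : derivable_pt_lim f y l ->
  differentiable_pt_lim (fun _ v => f v) x y 0 l.
Proof.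
intros H.
assert (D := differentiable_pt_lim_proj1_0 f y x l H).
intros e; destruct (D e) as [d Hd]; exists d; intros u v Hu Hv.
specialize (Hd v u Hv Hu).
rewrite Rmax_comm; replace (0 * (u - x) + l * (v - y))
  with (l * (v - y) + 0 * (u - x)) by ring.
exact Hd.
Qed.

Lemma differentiable_pt_lim_mult x y :
  differentiable_pt_lim Rmult x y y x.
Proof.
intros e; exists e; intros u v Hu Hv.
replace (u * v - x * y - (y * (u - x) + x * (v - y)))
  with ((u - x) * (v - y)) by ring.
rewrite Rabs_mult, Rmult_comm.
apply Rmult_le_compat; try apply Rabs_pos; [lra | apply Rmax_l].
Qed.

(** The complex exponential of [x + i y]. *)
Definition polar (x y : R) : C := (exp x * cos y, exp x * sin y).

Lemma Cmod_polar x y : Cmod (polar x y) = exp x.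
Proof.
unfold Cmod, polar; simpl.
replace (_ + _) with (exp x * exp x * ((sin y)² + (cos y)²))
  by (unfold Rsqr; ring).
rewrite sin2_cos2, Rmult_1_r; apply sqrt_square; left; apply exp_pos.
Qed.

Lemma differentiable_pt_lim_exp_mul f x y l : derivable_pt_lim f y l ->
  differentiable_pt_lim (fun u v => exp u * f v) x y (exp x * f y) (exp x * l).
Proof.
intros H.
replace (exp x * f y) with (f y * exp x + exp x * 0) by ring.
replace (exp x * l) with (f y * 0 + exp x * l) by ring.
apply (differentiable_pt_lim_comp Rmult (fun u _ => exp u) (fun _ v => f v)).
- apply differentiable_pt_lim_mult.
- apply differentiable_pt_lim_proj1_0, derivable_pt_lim_exp.
- now apply differentiable_pt_lim_snd.
Qed.

(** With [h = g o polar] holomorphic, this is the equality of the real part of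
    [dh/dx] and the imaginary part of [dh/dy], one of the two Cauchy-Riemann
    equations. *)
Lemma closed_form_polar (g : C -> C) (x y : R) (l : C) : is_C_derive g (polar x y) l ->
  closed_form_at (fun u v => Im (g (polar u v))) (fun u v => Re (g (polar u v)))
    x y.
Proof.
intros D.
assert (DX := differentiable_pt_lim_exp_mul cos x y _ (derivable_pt_lim_cos y)).
assert (DY := differentiable_pt_lim_exp_mul sin x y _ (derivable_pt_lim_sin y)).
assert (D1 := differentiable_pt_lim_comp (fun u v => Re (g (u, v))) _ _ _ _
  _ _ _ _ _ _ (is_C_derive_Re _ _ _ _ D) DX DY).
assert (D2 := differentiable_pt_lim_comp (fun u v => Im (g (u, v))) _ _ _ _
  _ _ _ _ _ _ (is_C_derive_Im _ _ _ _ D) DX DY).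
eexists _, _, _; split; [exact D2|].
match goal with |- differentiable_pt_lim _ _ _ ?k _ =>
  match type of D1 with differentiable_pt_lim _ _ _ ?k' _ =>
    replace k with k' by ring end end.
exact D1.
Qed.

(** * Means over circles and the Schwarz lemma *)

Lemma circle_mean_ex_RInt (g : C -> C) s :
  s < 0 -> (forall z, z <> RtoC 0 -> in_disc z ->
    @ex_derive C_AbsRing C_NormedModule g z) ->
  ex_RInt (fun t => Re (g (polar s t))) 0 (2 * PI).
Proof.
intros Hs H.
apply (@ex_RInt_continuous R_CompleteNormedModule); intros t _.
destruct (H (polar s t)) as [l D].
- apply Cmod_gt_0; rewrite Cmod_polar; apply exp_pos.
- unfold in_disc; rewrite Cmod_polar, <- exp_0; now apply exp_increasing.
- destruct (closed_form_polar g s t l D) as [k [k' [m [_ DQ]]]].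
  exact (differentiable_continuous_2 (fun u v => Re (g (polar u v))) s t k' m DQ).
Qed.

(** The circulation along [[s, s'] x [0, 2 pi]] vanishes, and its horizontal
    sides cancel because [polar] has period [2 pi] in its second argument.  A
    singularity of [g] at 0 is allowed. *)
Lemma circle_mean_invariant (g : C -> C) s s' : s <= s' -> s' < 0 ->
  (forall z, z <> RtoC 0 -> in_disc z ->
    @ex_derive C_AbsRing C_NormedModule g z) ->
  RInt (fun t => Re (g (polar s t))) 0 (2 * PI) =
  RInt (fun t => Re (g (polar s' t))) 0 (2 * PI).
Proof.
intros Hs Hs' H.
assert (HC : closed_form_on (fun u v => Im (g (polar u v)))
  (fun u v => Re (g (polar u v))) (s, s') (0, 2 * PI)).
{ intros x y Hx _; simpl in Hx.
  destruct (H (polar x y)) as [l D].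
  - apply Cmod_gt_0; rewrite Cmod_polar; apply exp_pos.
  - unfold in_disc; rewrite Cmod_polar, <- exp_0; apply exp_increasing; lra.
  - now apply closed_form_polar with l. }
assert (PP := PI_RGT_0).
assert (E := circulation_eq_0 _ _ _ _ HC Hs ltac:(simpl; lra)).
unfold circulation in E; simpl in E.
rewrite (RInt_ext (fun x => Im (g (polar x 0)) - Im (g (polar x (2 * PI))))
  (fun _ => 0)) in E.
2:{ intros x _; unfold polar; rewrite cos_2PI, sin_2PI, cos_0, sin_0.
    simpl; ring. }
rewrite RInt_const in E.
assert (X1 := circle_mean_ex_RInt g s ltac:(lra) H).
assert (X2 := circle_mean_ex_RInt g s' ltac:(lra) H).
assert (E' : RInt (fun y => Re (g (polar s' y)) - Re (g (polar s y))) 0 (2 * PI)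
  = RInt (fun t => Re (g (polar s' t))) 0 (2 * PI)
    - RInt (fun t => Re (g (polar s t))) 0 (2 * PI))
  by exact (@RInt_minus R_CompleteNormedModule _ _ _ _ X2 X1).
unfold scal in E; simpl in E; unfold mult in E; simpl in E.
rewrite E' in E; lra.
Qed.

(** The mean of [conj l * F(z) / z] is computed on two circles.  On a small one
    it is close to [|l|^2]; on the one of radius [exp s] its real part is at
    most [|l| exp (- s)].  Since the two agree, [|l| > 1] is impossible. *)
Lemma schwarz_derivative (F : C -> C) (l : C) : holomorphic_self_map F -> F (RtoC 0) = RtoC 0 ->
  is_C_derive F (RtoC 0) l -> Cmod l <= 1.
Proof.
intros [Hol Self] F0 D.
destruct (Rle_or_lt (Cmod l) 1) as [L|L]; [exact L | exfalso].
set (m := Cmod l) in *.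
set (g := fun z => Cdiv (Cmult (Cconj l) (F z)) z).
assert (Hg : forall z, z <> RtoC 0 -> in_disc z ->
  @ex_derive C_AbsRing C_NormedModule g z).
{ intros z Nz Hz; eexists; unfold g.
  apply is_C_derive_div; [exact Nz | | apply is_C_derive_id].
  apply is_derive_scal_C; assumption. }
assert (PP := PI_RGT_0).
(* The radius [2 / (1 + m)] is less than 1, and its inverse is less than [m]. *)
set (s := - ln ((1 + m) / 2)).
assert (Hs : s < 0).
{ assert (0 < ln ((1 + m) / 2)); [|unfold s; lra].
  rewrite <- ln_1; apply ln_increasing; lra. }
assert (Es : exp (- s) = (1 + m) / 2)
  by (unfold s; rewrite Ropp_involutive; apply exp_ln; lra).
assert (Up : RInt (fun t => Re (g (polar s t))) 0 (2 * PI)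
  <= 2 * PI * (m * ((1 + m) / 2))).
{ replace (2 * PI * (m * ((1 + m) / 2)))
    with (RInt (fun _ : R => m * ((1 + m) / 2)) 0 (2 * PI))
    by (rewrite RInt_const; unfold scal; simpl; unfold mult; simpl; ring).
  apply RInt_le; [lra | now apply circle_mean_ex_RInt | apply ex_RInt_const |].
  intros t _.
  apply Rle_trans with (1 := Rle_abs _), Rle_trans with (1 := Re_le_Cmod _).
  assert (Nz : polar s t <> RtoC 0)
    by (apply Cmod_gt_0; rewrite Cmod_polar; apply exp_pos).
  unfold g; rewrite Cmod_div by exact Nz.
  rewrite Cmod_mult, Cmod_conj, Cmod_polar; fold m.
  unfold Rdiv; rewrite <- exp_Ropp, Es.
  assert (B : in_disc (F (polar s t))).
  { apply Self; unfold in_disc; rewrite Cmod_polar, <- exp_0.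
    now apply exp_increasing. }
  unfold in_disc in B; assert (P := Cmod_ge_0 (F (polar s t))).
  rewrite Rmult_assoc; apply Rmult_le_compat_l; [lra|].
  nra. }
assert (He : 0 < (m - 1) / 4) by lra.
destruct (proj1 (is_C_derive_eps F (RtoC 0) l) D _ He) as [d [Hd HD]].
(* A radius on which [F(z)/z] is within [(m - 1) / 4] of [l]. *)
set (s' := Rmin s (ln (d / 2))).
assert (Hs' : s' <= s) by apply Rmin_l.
assert (Ed : exp s' < d).
{ apply Rle_lt_trans with (d / 2); [|lra].
  rewrite <- (exp_ln (d / 2)) by lra.
  apply Rnot_lt_le; intros X; apply exp_lt_inv in X.
  assert (M := Rmin_r s (ln (d / 2))); fold s' in M; lra. }
assert (Lo : 2 * PI * (m * m - m * ((m - 1) / 4))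
  <= RInt (fun t => Re (g (polar s' t))) 0 (2 * PI)).
{ replace (2 * PI * (m * m - m * ((m - 1) / 4)))
    with (RInt (fun _ : R => m * m - m * ((m - 1) / 4)) 0 (2 * PI))
    by (rewrite RInt_const; unfold scal; simpl; unfold mult; simpl; ring).
  apply RInt_le; [lra | apply ex_RInt_const | apply circle_mean_ex_RInt; trivial; lra |].
  intros t _.
  set (z := polar s' t).
  assert (Mz : Cmod z = exp s') by apply Cmod_polar.
  assert (Pz : 0 < Cmod z) by (rewrite Mz; apply exp_pos).
  assert (Nz : z <> RtoC 0) by now apply Cmod_gt_0.
  specialize (HD z).
  replace (Cminus z (RtoC 0)) with z in HD by ring.
  rewrite F0 in HD; replace (Cminus (F z) (RtoC 0)) with (F z) in HD by ring.
  specialize (HD ltac:(rewrite Mz; exact Ed)).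
  assert (E : g z = Cplus (RtoC (m * m))
    (Cdiv (Cmult (Cconj l) (Cminus (F z) (Cmult z l))) z)).
  { replace (RtoC (m * m)) with (Cmult l (Cconj l))
      by (rewrite <- Cmod2_conj; fold m; f_equal; ring).
    unfold g; field; exact Nz. }
  rewrite E; change (Re (Cplus ?a ?b)) with (Re a + Re b); simpl (Re (RtoC _)).
  set (r := Cdiv _ _).
  assert (Br : Cmod r <= m * ((m - 1) / 4)).
  { unfold r; rewrite Cmod_div by exact Nz.
    rewrite Cmod_mult, Cmod_conj; fold m.
    apply Rmult_le_reg_r with (1 := Pz).
    unfold Rdiv at 1; rewrite Rmult_assoc, Rinv_l by now apply Rgt_not_eq.
    nra. }
  assert (B := Rle_trans _ _ _ (Re_le_Cmod r) Br).
  apply Rabs_le_between in B; lra. }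
rewrite (circle_mean_invariant g s' s Hs' Hs Hg) in Lo.
assert (m * m - m * ((m - 1) / 4) <= m * ((1 + m) / 2)).
{ apply Rmult_le_reg_l with (2 * PI); lra. }
nra.
Qed.

(** * The Schwarz-Pick inequality *)

(** The automorphism of the disc which takes 0 to [a]; its inverse is
    [mobius (- a)]. *)
Definition mobius (a z : C) : C :=
  Cdiv (Cplus z a) (Cplus (RtoC 1) (Cmult (Cconj a) z)).

Lemma Cmod_sqr (z : C) : Cmod z ^ 2 = fst z ^ 2 + snd z ^ 2.
Proof.
unfold Cmod; rewrite <- Rsqr_pow2, Rsqr_sqrt; [reflexivity|].
apply Rplus_le_le_0_compat; apply pow2_ge_0.
Qed.

Lemma mobius_denominator a z : in_disc a -> in_disc z ->
  Cplus (RtoC 1) (Cmult (Cconj a) z) <> RtoC 0.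
Proof.
intros Ha Hz E.
assert (M : Cmod (Cmult (Cconj a) z) = 1).
{ replace (Cmult (Cconj a) z) with
    (Copp (Cminus (RtoC 1) (Cplus (RtoC 1) (Cmult (Cconj a) z)))) by ring.
  rewrite E, Cmod_opp.
  replace (Cminus (RtoC 1) (RtoC 0)) with (RtoC 1) by ring; apply Cmod_1. }
rewrite Cmod_mult, Cmod_conj in M.
unfold in_disc in *; assert (P := Cmod_ge_0 a); assert (Q := Cmod_ge_0 z).
nra.
Qed.

Lemma mobius_in_disc a z : in_disc a -> in_disc z -> in_disc (mobius a z).
Proof.
intros Ha Hz; assert (N := mobius_denominator a z Ha Hz).
unfold in_disc, mobius; rewrite Cmod_div by exact N.
assert (P := proj1 (Cmod_gt_0 _) N).
assert (Wa := weight_pos a Ha); assert (Wz := weight_pos z Hz).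
(* The identity behind the invariance of the disc. *)
assert (K : Cmod (Cplus (RtoC 1) (Cmult (Cconj a) z)) ^ 2
  - Cmod (Cplus z a) ^ 2 = (1 - Cmod a ^ 2) * (1 - Cmod z ^ 2)).
{ rewrite !Cmod_sqr; destruct a, z; simpl; ring. }
assert (Q := Cmod_ge_0 (Cplus z a)).
apply Rmult_lt_reg_r with (1 := P).
unfold Rdiv; rewrite Rmult_assoc, Rinv_l by now apply Rgt_not_eq.
nra.
Qed.

Lemma is_C_derive_mobius (a z : C) : in_disc a -> in_disc z ->
  is_C_derive (mobius a) z
    (Cdiv (RtoC (1 - Cmod a ^ 2))
      (Cmult (Cplus (RtoC 1) (Cmult (Cconj a) z))
        (Cplus (RtoC 1) (Cmult (Cconj a) z)))).
Proof.
intros Ha Hz; assert (N := mobius_denominator a z Ha Hz).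
assert (D1 := is_C_derive_affine (RtoC 1) a z).
assert (D2 := is_C_derive_affine (Cconj a) (RtoC 1) z).
assert (N' : Cplus (Cmult (Cconj a) z) (RtoC 1) <> RtoC 0)
  by now rewrite Cplus_comm.
assert (D := is_C_derive_div (fun w => Cplus (Cmult (RtoC 1) w) a)
  (fun w => Cplus (Cmult (Cconj a) w) (RtoC 1)) z _ _ N' D1 D2).
rewrite RtoC_minus, Cmod2_conj.
match type of D with is_derive _ _ ?l => match goal with
  |- is_derive _ _ ?l' => replace l' with l by (field; auto) end end.
apply is_derive_ext with (2 := D).
intros w; unfold mobius; f_equal; ring.
Qed.

(** [schwarz_derivative] applied to [mobius (- phi z) o phi o mobius z], whose
    derivative at 0 is [phi'(z) (1 - |z|^2) / (1 - |phi(z)|^2)]. *)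
Theorem schwarz_pick (phi : C -> C) (z : C) : holomorphic_self_map phi ->
  in_disc z ->
  (1 - Cmod z ^ 2) * Cmod (C_derive phi z) <= 1 - Cmod (phi z) ^ 2.
Proof.
intros [Hol Self] Hz.
set (b := phi z); assert (Hb : in_disc b) by now apply Self.
assert (Hb' : in_disc (Copp b)) by (unfold in_disc; now rewrite Cmod_opp).
set (F := fun w => mobius (Copp b) (phi (mobius z w))).
assert (Z0 : mobius z (RtoC 0) = z)
  by (unfold mobius; field; intros E; injection E; lra).
assert (DF : forall w, in_disc w -> exists l : C, is_C_derive F w l /\
  l = Cmult (Cmult (Cdiv (RtoC (1 - Cmod z ^ 2))
      (Cmult (Cplus (RtoC 1) (Cmult (Cconj z) w))
        (Cplus (RtoC 1) (Cmult (Cconj z) w))))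
    (C_derive phi (mobius z w)))
    (Cdiv (RtoC (1 - Cmod (Copp b) ^ 2))
      (Cmult (Cplus (RtoC 1) (Cmult (Cconj (Copp b)) (phi (mobius z w))))
        (Cplus (RtoC 1) (Cmult (Cconj (Copp b)) (phi (mobius z w))))))).
{ intros w Hw.
  assert (Hm := mobius_in_disc z w Hz Hw).
  eexists; split; [|reflexivity].
  apply (is_C_derive_comp (mobius (Copp b)) (fun w => phi (mobius z w))).
  - apply is_C_derive_mobius; [exact Hb' | now apply Self].
  - apply (is_C_derive_comp phi (mobius z)).
    + now apply is_derive_C_derive.
    + now apply is_C_derive_mobius. }
destruct (DF _ in_disc_0) as [l [D El]].
assert (L : Cmod l <= 1).
{ apply schwarz_derivative with F.
  - split.
    + intros w Hw; destruct (DF w Hw) as [k [Dk _]]; now exists k.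
    + intros w Hw; apply mobius_in_disc; [exact Hb'|].
      now apply Self, mobius_in_disc.
  - unfold F; rewrite Z0; fold b; unfold mobius.
    assert (N := mobius_denominator (Copp b) b Hb' Hb).
    replace (Cplus b (Copp b)) with (RtoC 0) by ring.
    unfold Cdiv; ring.
  - exact D. }
assert (Wz := weight_pos z Hz); assert (Wb := weight_pos b Hb).
rewrite Z0, Cmod_opp in El; fold b in El.
assert (E1 : Cplus (RtoC 1) (Cmult (Cconj (Copp b)) b) = RtoC (1 - Cmod b ^ 2)).
{ rewrite RtoC_minus, Cmod2_conj.
  apply injective_projections; simpl; ring. }
rewrite E1 in El.
assert (Nb : RtoC (1 - Cmod b ^ 2) <> RtoC 0)
  by (intros E; injection E; lra).
assert (E2 : l = Cdiv (Cmult (RtoC (1 - Cmod z ^ 2)) (C_derive phi z))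
  (RtoC (1 - Cmod b ^ 2))).
{ rewrite El.
  replace (Cplus (RtoC 1) (Cmult (Cconj z) (RtoC 0))) with (RtoC 1) by ring.
  field; exact Nb. }
rewrite E2, Cmod_div, Cmod_mult, !Cmod_R, !Rabs_pos_eq in L by (lra || exact Nb).
apply Rmult_le_reg_r with (/ (1 - Cmod b ^ 2)).
- now apply Rinv_0_lt_compat.
- rewrite Rinv_r by lra; exact L.
Qed.

(** * Orbits in the little Bloch space *)

Lemma locally_in_disc (z : C) : in_disc z ->
  @locally (AbsRing_UniformSpace C_AbsRing) z in_disc.
Proof.
intros Hz; unfold in_disc in Hz.
assert (P : 0 < 1 - Cmod z) by lra.
exists (mkposreal _ P); intros w Hw; change C in (type of w).
change (Cmod (Cminus w z) < 1 - Cmod z) in Hw.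
assert (T := Cmod_triangle (Cminus w z) z).
replace (Cplus (Cminus w z) z) with w in T by ring.
unfold in_disc; lra.
Qed.

Lemma is_C_derive_ext_disc (f g : C -> C) (z l : C) : in_disc z ->
  (forall w, in_disc w -> f w = g w) ->
  is_C_derive f z l -> is_C_derive g z l.
Proof.
intros Hz E.
apply (@is_derive_ext_loc C_AbsRing C_NormedModule f g).
apply filter_imp with (2 := locally_in_disc z Hz); exact E.
Qed.

(** By the chain rule the weight of [g] at [z] is
    [(1 - |z|^2) |phi'(z)| |f'(phi z)|], and Schwarz-Pick bounds the first two
    factors by [1 - |phi z|^2].  Since [g] is only prescribed on the disc, the
    lemma applies to functions extended by zero outside it. *)
Lemma weighted_composition_contracts (lambda : C) (phi f g : C -> C) :
  Cmod lambda = 1 -> holomorphic_self_map phi -> holomorphic_on_disc f ->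
  (forall z, in_disc z -> g z = Cmult lambda (f (phi z))) ->
  forall z, in_disc z -> bloch_weight g z <= bloch_weight f (phi z).
Proof.
intros Hl Hphi Hf E z Hz.
assert (SP := schwarz_pick phi z Hphi Hz).
destruct Hphi as [Hol Self].
assert (Dc : forall w, in_disc w -> is_C_derive (fun w => f (phi w)) w
  (Cmult (C_derive phi w) (C_derive f (phi w)))).
{ intros w Hw; apply is_C_derive_comp; apply is_derive_C_derive; auto. }
assert (Hc : holomorphic_on_disc (fun w => f (phi w)))
  by (intros w Hw; eexists; now apply Dc).
assert (Dg : C_derive g z =
  Cmult lambda (Cmult (C_derive phi z) (C_derive f (phi z)))).
{ apply is_C_derive_unique.
  apply is_C_derive_ext_disc with (fun w => Cmult lambda (f (phi w)));
    [exact Hz | intros w Hw; symmetry; now apply E |].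
  rewrite <- (is_C_derive_unique _ _ _ (Dc z Hz)).
  now apply (is_derive_scal_C lambda (fun w => f (phi w))). }
unfold bloch_weight; rewrite Dg, !Cmod_mult, Hl, Rmult_1_l, <- Rmult_assoc.
apply Rmult_le_compat_r; [apply Cmod_ge_0 | exact SP].
Qed.

Lemma little_bloch_ext f g : (forall z, in_disc z -> f z = g z) ->
  little_bloch f -> little_bloch g.
Proof.
intros E [Bf Lf].
assert (D : forall z, in_disc z -> is_C_derive g z (C_derive f z)).
{ intros z Hz; apply is_C_derive_ext_disc with f; trivial.
  apply is_derive_C_derive; trivial; apply Bf. }
assert (W : forall z, in_disc z -> bloch_weight g z = bloch_weight f z).
{ intros z Hz; unfold bloch_weight.
  now rewrite (is_C_derive_unique _ _ _ (D z Hz)). }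
split.
- apply bloch_intro with (real (bloch_seminorm f)).
  + intros z Hz; eexists; now apply D.
  + intros z Hz; rewrite W by exact Hz; now apply bloch_weight_le.
- intros e He; destruct (Lf e He) as [r [Hr H]].
  exists r; split; [exact Hr|]; intros z Hz.
  rewrite W by apply Hz; now apply H.
Qed.

Lemma little_bloch_id : little_bloch (fun z => z).
Proof.
assert (W : forall z, bloch_weight (fun z => z) z = 1 - Cmod z ^ 2).
{ intros z; unfold bloch_weight.
  replace (C_derive (fun z => z) z) with (RtoC 1)
    by (symmetry; apply is_C_derive_unique, is_C_derive_id).
  rewrite Cmod_1; ring. }
split.
- apply bloch_intro with 1.
  + intros z _; eexists; apply is_C_derive_id.
  + intros z _; rewrite W; assert (P := pow2_ge_0 (Cmod z)); lra.
- intros e He; exists (1 - e / 2); split; [lra|].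
  intros z [H1 H2]; rewrite W; assert (P := Cmod_ge_0 z); nra.
Qed.

(** The witness is [M z], extended by zero outside the disc; it gives [B0]
    elements of arbitrarily large seminorm. *)
Lemma B0_exists_derivative_0 (M : R) : exists g : B0, C_derive g (RtoC 0) = RtoC M.
Proof.
set (g := fun z => if Rlt_dec (Cmod z) 1 then Cmult (RtoC M) z else RtoC 0).
assert (E : forall z, in_disc z -> Cmult (RtoC M) z = g z).
{ intros z Hz; unfold g; now destruct (Rlt_dec (Cmod z) 1). }
assert (Lg : little_bloch g).
{ apply little_bloch_ext with (1 := E).
  apply (little_bloch_scal (RtoC M) (fun z => z)), little_bloch_id. }
assert (Og : forall z, ~ in_disc z -> g z = RtoC 0).
{ intros z Hz; unfold g; now destruct (Rlt_dec (Cmod z) 1). }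
exists (mkB0 g Lg Og); apply is_C_derive_unique.
apply is_C_derive_ext_disc with (1 := in_disc_0) (2 := E).
apply is_derive_ext with (2 := is_C_derive_affine (RtoC M) (RtoC 0) (RtoC 0)).
intros w; apply Cplus_0_r.
Qed.

Theorem corollary3p3 :
  forall (lambda : C) (phi : C -> C),
    Cmod lambda = 1 ->
    holomorphic_self_map phi ->
    forall C_phi : B0 -> B0,
      is_composition_operator phi C_phi ->
      is_linear C_phi ->
      ~ hypercyclic (fun f : B0 => scal lambda (C_phi f)).
Proof.
intros lambda phi Hl Hphi T HT _ [f Hf].
set (S := fun f : B0 => scal lambda (T f)) in *.
set (M := real (bloch_seminorm f)).
assert (Orbit : forall n z, in_disc z -> bloch_weight (Nat.iter n S f) z <= M).
{ induction n as [|n IH]; intros z Hz.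
  - apply bloch_weight_le; [apply B0_little_bloch | exact Hz].
  - apply Rle_trans with (bloch_weight (Nat.iter n S f) (phi z)).
    + apply weighted_composition_contracts with lambda; trivial.
      * apply B0_little_bloch.
      * intros w Hw.
        change (Cmult lambda (T (Nat.iter n S f) w)
          = Cmult lambda (Nat.iter n S f (phi w))).
        now rewrite HT.
    + now apply IH, Hphi. }
destruct (B0_exists_derivative_0 (M + 1)) as [g Hg].
destruct (Hf g (ball g (mkposreal 1 Rlt_0_1))) as [h [[n ->] Hh]].
{ apply locally_ball. }
rewrite B0_ball in Hh; simpl in Hh.
(* At 0 the weight is the modulus of the derivative: at most [M] on the orbit,
   but [M + 1] for [g], so their distance cannot be less than 1. *)
assert (B := B0_weight_le (minus (Nat.iter n S f) g) (RtoC 0) in_disc_0).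
assert (O := Orbit n _ in_disc_0).
unfold bloch_weight in B, O.
rewrite B0_derive_minus, Hg in B by apply in_disc_0.
rewrite Cmod_0 in B, O.
set (d := C_derive (Nat.iter n S f) (RtoC 0)) in *.
assert (Tr := Cmod_triangle d (Cminus (RtoC (M + 1)) d)).
replace (Cplus d (Cminus (RtoC (M + 1)) d)) with (RtoC (M + 1)) in Tr by ring.
replace (Cminus (RtoC (M + 1)) d) with (Copp (Cminus d (RtoC (M + 1)))) in Tr
  by ring.
rewrite Cmod_opp, Cmod_R in Tr.
assert (PM := real_bloch_seminorm_ge0 f); fold M in PM.
rewrite Rabs_pos_eq in Tr by lra.
simpl in B, O; nra.
Qed.
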